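(* There is an absolute constant $C>0$ such that for all integers $n\ge1$, $k\ge2$ and every pathset $\mathcal{A}\in\mathcal{P}_{P_k}$, $$\chi_{P_k}(\mathcal{A})\ \ge\ \frac{n^{(1/6)\log k}}{2^{C\cdot 2^k}}\cdot\delta(\mathcal{A}).$$
   Context: Logarithms are base 2. $P_k$ is the directed path with vertex set $V_k=\{v_0,\dots,v_k\}$ and edge set $E_k=\{v_iv_{i+1}:0\le i<k\}$. A pattern graph is a graph $G=(V_G,E_G)$ with $E_G\subseteq E_k$ and $V_G$ equal to the set of endpoints of edges in $E_G$ (the empty graph is allowed); $c(G)$ denotes its number of connected components. For a finite set $V$, $[n]^V$ is the set of maps $V\to[n]$ (with $[n]^\emptyset=\{()\}$); for $x\in[n]^V$ and $S\subseteq V$, $x_S$ is the restriction of $x$ to $S$; for disjoint $V,W$ and $x\in[n]^V,y\in[n]^W$, $xy\in[n]^{V\cup W}$ is their common extension. For $\mathcal{A}\subseteq[n]^V$: $\delta(\mathcal{A})=|\mathcal{A}|/n^{|V|}$; for $S\subseteq V$ and $z\in[n]^{V\setminus S}$ let $\mathcal{A}|^z_S=\{y\in[n]^S: yz\in\mathcal{A}\}$ and $\mu_S(\mathcal{A})=\max_{z}|\mathcal{A}|^z_S|/n^{|S|}$. For $\mathcal{A}\subseteq[n]^V,\mathcal{B}\subseteq[n]^W$, the join is $\mathcal{A}\bowtie\mathcal{B}=\{x\in[n]^{V\cup W}:x_V\in\mathcal{A},x_W\in\mathcal{B}\}$. A $G$-pathset is a subset of $[n]^{V_G}$; $\mathcal{P}_G$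 is the set of $G$-pathsets. Let $\varepsilon=1/\log k$ and $\tilde n=n^{1-\varepsilon}$. $\mathcal{A}\in\mathcal{P}_G$ is $G$-small if for every $1\le t\le c(G)$ and every $S\subseteq V_G$ that is the union of the vertex sets of $t$ components of $G$, $\mu_S(\mathcal{A})\le\tilde n^{-t}$; $\mathcal{P}^{\mathrm{small}}_G$ is the set of $G$-small pathsets. Pathset complexity $\chi_G(\mathcal{A})$ is defined by induction on $|E_G|$: if $G$ is empty, $\chi_G(\mathcal{A})=0$; if $|E_G|=1$, $\chi_G(\mathcal{A})=|\mathcal{A}|$; if $|E_G|\ge2$, $\chi_G(\mathcal{A})=\min\sum_i\big(\chi_{H_i}(\mathcal{B}_i)+\chi_{K_i}(\mathcal{C}_i)\big)$ over finite sequences $(H_i,K_i,\mathcal{B}_i,\mathcal{C}_i)_i$ where $H_i,K_i$ are pattern graphs that are proper subgraphs of $G$ with $H_i\cup K_i=G$, $\mathcal{B}_i\in\mathcal{P}^{\mathrm{small}}_{H_i}$, $\mathcal{C}_i\in\mathcal{P}^{\mathrm{small}}_{K_i}$, and $\mathcal{A}\subseteq\bigcup_i\mathcal{B}_i\bowtie\mathcal{C}_i$. *)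

(* Defs.v *)
From HB Require Import structures.
From mathcomp Require Import all_boot all_order all_algebra.
From mathcomp Require Import boolp reals exp.

Set Implicit Arguments.
Unset Strict Implicit.
Unset Printing Implicit Defensive.

Import Order.TTheory GRing.Theory Num.Theory.
Local Open Scope ring_scope.

Definition log2 {R : realType} (x : R) : R := ln x / ln 2.

(** Vertices are ['I_k.+1]; [i : 'I_k] stands for the edge v_i v_{i+1}.  As the
    vertex set of a pattern graph is the set of endpoints of its edges, a
    pattern graph is given by its edge set [G : {set 'I_k}]; subgraph is
    [\subset], union is [:|:], and P_k is [[set: 'I_k]]. *)

Definition verts k (G : {set 'I_k}) : {set 'I_k.+1} :=
  [set v : 'I_k.+1 | [exists i in G, (val v == val i) || (val v == (val i).+1)]].

Definition adj k (G : {set 'I_k}) : rel 'I_k.+1 :=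
  fun v w => [exists i in G,
    ((val v == val i) && (val w == (val i).+1)) ||
    ((val w == val i) && (val v == (val i).+1))].

(** The vertex sets of the connected components; c(G) is [#|components G|]. *)
Definition components k (G : {set 'I_k}) : {set {set 'I_k.+1}} :=
  equivalence_partition (connect (adj G)) (verts G).

(** An element of [n]^V is represented as a partial map with domain exactly
    [V]; a G-pathset is then a subset of [assign n (verts G)]. *)

Notation passign n k := {ffun 'I_k.+1 -> option 'I_n}.

Definition assign n k (V : {set 'I_k.+1}) : {set passign n k} :=
  [set x : passign n k | [forall v, (x v : bool) == (v \in V)]].
Arguments assign n {k} V.

Definition restr n k (S : {set 'I_k.+1}) (x : passign n k) : passign n k :=
  [ffun v => if v \in S then x v else None].

(** The common extension xy; only used on disjoint domains. *)
Definition glue n k (x y : passign n k) : passign n k :=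
  [ffun v => if x v is Some a then Some a else y v].

Definition join n k (V W : {set 'I_k.+1}) (A B : {set passign n k})
    : {set passign n k} :=
  [set x in assign n (V :|: W) | (restr V x \in A) && (restr W x \in B)].

Definition slice n k (S : {set 'I_k.+1}) (A : {set passign n k})
    (z : passign n k) : {set passign n k} :=
  [set y in assign n S | glue y z \in A].

Definition density (R : realType) n k (V : {set 'I_k.+1})
    (A : {set passign n k}) : R :=
  #|A|%:R / n%:R ^+ #|V|.

(** [mu R V S A] is mu_S(A) for A a subset of [n]^V and S a subset of V. *)
Definition mu (R : realType) n k (V S : {set 'I_k.+1})
    (A : {set passign n k}) : R :=
  (\max_(z in assign n (V :\: S)) #|slice S A z|)%N%:R / n%:R ^+ #|S|.

(** n^(1 - 1/log k) *)
Definition ntilde (R : realType) (n k : nat) : R :=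
  n%:R `^ (1 - 1 / log2 k%:R).

Definition pathset n k (G : {set 'I_k}) (A : {set passign n k}) : Prop :=
  A \subset assign n (verts G).

Definition small (R : realType) n k (G : {set 'I_k}) (A : {set passign n k})
    : Prop :=
  forall (t : nat) (D : {set {set 'I_k.+1}}),
    (1 <= t <= #|components G|)%N -> D \subset components G -> #|D| = t ->
    mu R (verts G) (cover D) A <= (ntilde R n k) ^- t.

Definition small_pathset (R : realType) n k (G : {set 'I_k})
    (A : {set passign n k}) : Prop :=
  pathset G A /\ small R G A.

(** The minimum of a nonempty set of naturals (0 on the empty set). *)
Definition nat_min (P : nat -> Prop) : nat :=
  if pselect (exists s, `[< P s >]) is left h then ex_minn h else 0%N.

Definition covering_cost (R : realType) n k
    (c : {set 'I_k} -> {set passign n k} -> nat)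
    (G : {set 'I_k}) (A : {set passign n k}) (s : nat) : Prop :=
  exists (m : nat) (H K : 'I_m -> {set 'I_k})
         (B C : 'I_m -> {set passign n k}),
    [/\ forall i, [/\ H i \proper G, K i \proper G & H i :|: K i = G],
        forall i, small_pathset R (H i) (B i) /\ small_pathset R (K i) (C i),
        A \subset \bigcup_i join (verts (H i)) (verts (K i)) (B i) (C i)
      & s = (\sum_i (c (H i) (B i) + c (K i) (C i)))%N].

(** Recursion on a fuel that bounds the number of edges; [chiE] below is the
    defining recursive equation. *)
Fixpoint chi_rec (R : realType) n k (fuel : nat) (G : {set 'I_k})
    (A : {set passign n k}) : nat :=
  if #|G| == 0%N then 0%N
  else if #|G| == 1%N then #|A|
  else if fuel is f.+1 then nat_min (covering_cost R (@chi_rec R n k f) G A)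
  else 0%N.

Definition chi (R : realType) n k (G : {set 'I_k}) (A : {set passign n k})
    : nat :=
  chi_rec R #|G| G A.

Lemma nat_minP (P : nat -> Prop) : (exists s, P s) ->
  P (nat_min P) /\ forall s, P s -> (nat_min P <= s)%N.
Proof.
move=> [s0 Ps0]; rewrite /nat_min; case: pselect => [h|[]]; last first.
  by exists s0; apply/asboolP.
case: ex_minnP => m /asboolP Pm le_m; split=> // s Ps.
by apply: le_m; apply/asboolP.
Qed.

Lemma eq_covering_cost (R : realType) n k
    (c c' : {set 'I_k} -> {set passign n k} -> nat) (G : {set 'I_k}) A :
  (forall (H : {set 'I_k}) B, H \proper G -> c H B = c' H B) ->
  covering_cost R c G A = covering_cost R c' G A.
Proof.
move=> cc'; apply/funext => s; apply/propext.
split=> -[m [H [K [B [C [HK sm AS ->]]]]]]; exists m, H, K, B, C; split=> //;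
  by apply: eq_bigr => i _; have [pH pK _] := HK i; rewrite !cc'.
Qed.

Lemma chi_rec_fuel (R : realType) n k f g (G : {set 'I_k})
    (A : {set passign n k}) :
  (#|G| <= f)%N -> (#|G| <= g)%N -> chi_rec R f G A = chi_rec R g G A.
Proof.
elim: f g G A => [|f IH] [|g] G A //.
- by rewrite leqn0 => /eqP G0 _; rewrite /= G0.
- by move=> _; rewrite leqn0 => /eqP G0; rewrite /= G0.
move=> lef leg /=; case: ifP => // _; case: ifP => // _; congr nat_min.
apply: eq_covering_cost => H B /proper_card ltHG.
by apply: IH; rewrite -ltnS (leq_trans ltHG).
Qed.

Lemma chiE (R : realType) n k (G : {set 'I_k}) (A : {set passign n k}) :
  chi R G A =
    if #|G| == 0%N then 0%N
    else if #|G| == 1%N then #|A|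
    else nat_min (covering_cost R (@chi R n k) G A).
Proof.
rewrite {1}/chi; case Eg: #|G| => [|g] /=; rewrite Eg //=.
case: ifP => // _; congr nat_min; apply: eq_covering_cost => H B pH.
by apply: chi_rec_fuel => //; rewrite -ltnS -Eg; exact: proper_card.
Qed.

Lemma restr_assign n k (V W : {set 'I_k.+1}) (x : passign n k) :
  x \in assign n V -> W \subset V -> restr W x \in assign n W.
Proof.
rewrite !inE => /forallP xV WV; apply/forallP => v; rewrite ffunE.
by case: ifP => // vW; have /eqP -> := xV v; rewrite (subsetP WV).
Qed.

Lemma card_cover_components k (G : {set 'I_k}) (D : {set {set 'I_k.+1}}) :
  D \subset components G -> (#|D| <= #|cover D|)%N.
Proof.
move=> DG.
have adjC : connect_sym (adj G).
  by apply: sym_connect_sym => v w; apply: eq_existsb => i; rewrite orbC.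
have /and3P[_ trivG nG] : partition (components G) (verts G).
  apply: equivalence_partitionP => u v w _ _ _; split; first exact: connect0.
  by move=> uv; rewrite (same_connect adjC uv).
have /eqP <- := trivIsetS DG trivG.
rewrite -sum1_card leq_sum // => S SD; rewrite card_gt0.
by apply: contraNneq nG => <-; exact: (subsetP DG).
Qed.

Lemma small_set1 (R : realType) n k (G : {set 'I_k}) (x : passign n k) :
  (1 <= n)%N -> (2 <= k)%N -> small R G [set x].
Proof.
move=> n1 k2 t D _ DG Dt.
have n0 : 0 < n%:R :> R by rewrite ltr0n.
have nt0 : 0 < ntilde R n k by apply: powR_gt0.
have ntn : ntilde R n k <= n%:R.
  rewrite -[leRHS]powRr1 ?ler0n// ler_powR ?ler1n// gerBl divr_ge0// /log2.
  by rewrite divr_ge0// ln_ge0 ?ler1n// (leq_trans _ k2).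
apply: (@le_trans _ _ (1 / n%:R ^+ #|cover D|)).
  rewrite ler_pM2r ?invr_gt0 ?exprn_gt0//.
  rewrite lern1; apply/bigmax_leqP => z zV; apply/card_le1_eqP.
  move=> y y'; rewrite !inE => /andP[/forallP yS /eqP yx] /andP[/forallP y'S /eqP y'x].
  apply/ffunP => v; move/ffunP/(_ v): yx; move/ffunP/(_ v): y'x; rewrite !ffunE.
  have := yS v; have := y'S v.
  by case: (y v) => [a|]; case: (y' v) => [b|] //= /eqP <- // _ <-.
rewrite div1r lef_pV2 ?posrE ?exprn_gt0//.
apply: (@le_trans _ _ (n%:R ^+ t)).
  by apply: lerXn2r ntn; rewrite nnegrE ltW.
by rewrite -Dt ler_weXn2l ?ler1n// (card_cover_components DG).
Qed.

(** The minimum defining [chi] is taken over a nonempty set. *)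
Lemma covering_exists (R : realType) n k c (G : {set 'I_k})
    (A : {set passign n k}) :
  (1 <= n)%N -> (2 <= k)%N -> (2 <= #|G|)%N -> pathset G A ->
  exists s, covering_cost R c G A s.
Proof.
move=> n1 k2 G2 AG; have [e eG] : exists e, e \in G.
  by apply/card_gt0P; exact: ltnW.
have eq_G : [set e] :|: G :\ e = G by rewrite setD1K.
have vertsU : verts [set e] :|: verts (G :\ e) = verts G.
  apply/setP => v; rewrite -[in RHS]eq_G !inE.
  apply/orP/exists_inP => [[]/exists_inP[i iH vi]|[i]].
  - by exists i; rewrite // inE iH.
  - by exists i; rewrite // inE iH orbT.
  - by rewrite inE => /orP[] iH vi; [left|right]; apply/exists_inP; exists i.
pose x (i : 'I_#|A|) := enum_val i.
have xG i : x i \in assign n (verts G) by apply: (subsetP AG); exact: enum_valP.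
exists (\sum_(i < #|A|) (c [set e] [set restr (verts [set e]) (x i)] +
                c (G :\ e) [set restr (verts (G :\ e)) (x i)]))%N.
exists #|A|, (fun=> [set e]), (fun=> G :\ e),
  (fun i => [set restr (verts [set e]) (x i)]),
  (fun i => [set restr (verts (G :\ e)) (x i)]); split=> //.
- move=> _; split=> //; last exact: properD1.
  by rewrite properEcard sub1set eG cards1.
- move=> i; split; split; rewrite ?/pathset ?sub1set; do ?exact: small_set1.
  + by apply: restr_assign (xG i) _; rewrite -vertsU subsetUl.
  + by apply: restr_assign (xG i) _; rewrite -vertsU subsetUr.
- apply/subsetP => y yA; apply/bigcupP; exists (enum_rank_in yA y) => //.
  by rewrite /join vertsU inE (subsetP AG)//= /x enum_rankK_in// !set11.
Qed.

(* Main.v *)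
(** A covering that achieves the complexity is a tree of joins.  Sorting its
    members by the shape of that tree (a "join tree", whose leaves are edges)
    splits [A] into at most [16 ^ 2 ^ k] parts, so one shape can be fixed.

    For a fixed tree one bounds the density of a pathset, with the coordinates in
    a set [S] fixed, in terms of its cost; call the exponent of [ntilde] gained
    the potential of the tree.  In a join, the components of one factor that miss
    the other factor and [S] contribute one unit each, by smallness; one can also
    pay one factor out completely and go on in the other one with its vertices
    added to [S].  By induction on [r], the potential is at least

    - [r / 3] plus the number of free components (those disjoint from [S]), when
      some free component has [4 ^ r] vertices;
    - [(r + 2) / 3] plus the number of free components avoiding [Y], when [Y] is a
      subpath disjoint from [S] with [4 ^ r] vertices.

    For the first claim, go down the tree to a node [t] that retains between a
    quarter and a half of the long component [X].  As the pathset is small on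
    [X], either its projection to the vertices of [t] has density at most
    [ntilde ^- (2/3)], and one goes on at the same node with these vertices fixed
    and a subpath of the rest of [X]; or the rest of [X] has density at most
    [ntilde ^- (1/3)] given [t], and one goes on at [t].  For the second claim, go
    down until [Y] is broken; then a quarter of [Y] becomes a free component, or
    a component inside [Y] is absorbed.  Each unit [1/3] thus costs a factor 4 in
    length, which gives [1/6 * log k]. *)

Require Import Defs.
From HB Require Import structures.
From mathcomp Require Import all_boot all_order all_algebra.
From mathcomp Require Import boolp reals exp.
From mathcomp Require Import zify ring lra.

Set Implicit Arguments.
Unset Strict Implicit.
Unset Printing Implicit Defensive.

(** * Set lemmas and the arithmetic of lengths *)

Lemma disjoint_setUr (T : finType) (X S Y : {set T}) :
  [disjoint X & S :|: Y] = [disjoint X & S] && [disjoint X & Y].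
Proof. by rewrite -!setI_eq0 setIUr setU_eq0. Qed.

Lemma meetP (T : finType) (X Y : {set T}) :
  reflect (exists2 x, x \in X & x \in Y) (~~ [disjoint X & Y]).
Proof.
rewrite -setI_eq0; apply: (iffP idP) => [/set0Pn[x /setIP[xX xY]]|[x xX xY]].
  by exists x.
by apply/set0Pn; exists x; apply/setIP.
Qed.

Lemma leq_expn4 s : (0 < s) -> (s <= 4 ^ (3 * s - 3)).
Proof.
case: s => // s _; have -> : (3 * s.+1 - 3 = 3 * s) by lia.
by elim: s => // s IH; rewrite mulnS expnD; lia.
Qed.

(** In [long_subtree], [h] pieces shorter than [4 ^ (r + 4 - 3 * h)] have at most [4 ^ r] vertices
    together. Where the subtraction truncates, such pieces are empty. *)
Lemma mul_expn4_le r h : (1 < h) -> (h * (4 ^ (r + 4 - 3 * h)).-1 <= 4 ^ r).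
Proof.
move=> h1; have [rh|rh] := leqP (r + 4) (3 * h).
  have -> : (r + 4 - 3 * h = 0) by lia.
  by rewrite muln0.
have [m ->] : exists m, r = ((3 * h - 3) + m) by exists (r + 3 - 3 * h); lia.
have -> : (3 * h - 3 + m + 4 - 3 * h = m.+1) by lia.
have hq : (h.-1 <= 4 ^ (3 * h.-1 - 3)) by apply: leq_expn4; lia.
have -> : (3 * h - 3 = 3 + (3 * h.-1 - 3)) by lia.
rewrite !expnD expnS; move: (4 ^ (3 * h.-1 - 3)) hq => q hq.
have : (0 < 4 ^ m) by rewrite expn_gt0.
by move: (4 ^ m) => u; nia.
Qed.

(** The count behind [bound_inner]: [s] inner components and [s + 3] further pieces (two sides and
    [s + 1] gaps), all below their length thresholds, cannot fill a segment of length
    [2 * 4 ^ r]. *)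
Lemma split_arith r s : (0 < s) ->
  (s * (4 ^ (r + 3 - 3 * s)).-1 + (s + 3) * (4 ^ (r + 1 - 3 * s)).-1 < 2 * 4 ^ r).
Proof.
move=> s0; have sq := leq_expn4 s0; have p0 m : (0 < 4 ^ m) by rewrite expn_gt0.
have [rs|rs] := leqP (r + 3) (3 * s).
  have -> : (r + 3 - 3 * s = 0) by lia.
  have -> : (r + 1 - 3 * s = 0) by lia.
  by have := p0 r; lia.
have [m ->] : exists m, r = ((3 * s - 3) + m.+1) by exists (r + 2 - 3 * s); lia.
have -> : (3 * s - 3 + m.+1 + 3 - 3 * s = m.+1) by lia.
have -> : (3 * s - 3 + m.+1 + 1 - 3 * s = m.-1) by lia.
rewrite expnD; move: (4 ^ (3 * s - 3)) sq (p0 (3 * s - 3)) => q sq q0.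
case: m => [|m] /=; first by nia.
by rewrite !expnS; have := p0 m; move: (4 ^ m) => u; nia.
Qed.

(** * Components of subgraphs of the path *)

Section PathGraphs.
Variable k : nat.
Implicit Types (G H : {set 'I_k}) (u v w x y z : 'I_k.+1) (S X Y Z O : {set 'I_k.+1}).

(** On a path, connectivity amounts to the presence of all edges in between ([connect_adjE]), so it
    can be handled by linear arithmetic. *)
Definition linked G : rel 'I_k.+1 := fun v w =>
  [forall i : 'I_k, (minn v w <= i < maxn v w) ==> (i \in G)].

Lemma linkedP G v w :
  reflect (forall i : 'I_k, minn v w <= i < maxn v w -> i \in G) (linked G v w).
Proof. by apply: (iffP forallP) => h i; [apply/implyP | apply/implyP/h]. Qed.

Lemma linkedxx G v : linked G v v.
Proof. by apply/linkedP => i; lia. Qed.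

Lemma linked_sym G v w : linked G v w = linked G w v.
Proof. by rewrite /linked minnC maxnC. Qed.

Lemma linked_trans G v w x : linked G v w -> linked G w x -> linked G v x.
Proof.
move=> /linkedP vw /linkedP wx; apply/linkedP => i ivx.
have [ivw|ivw] := boolP (minn v w <= i < maxn v w); first exact: vw.
by apply: wx; lia.
Qed.

Lemma linked_sub G H v w : H \subset G -> linked H v w -> linked G v w.
Proof. by move=> HG /linkedP vw; apply/linkedP => i /vw /(subsetP HG). Qed.

Lemma linked_between G v w x y : minn v w <= minn x y -> maxn x y <= maxn v w ->
  linked G v w -> linked G x y.
Proof. by move=> ? ? /linkedP vw; apply/linkedP => i ?; apply: vw; lia. Qed.

Lemma connect_adjE G v w : connect (adj G) v w = linked G v w.
Proof.
apply/idP/idP => [/connectP[p]|].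
  elim: p v => [|u p IH] v /=; first by move=> _ ->; exact: linkedxx.
  move=> /andP[/existsP[i /andP[iG vu]] pth] wlast.
  apply: linked_trans (IH u pth wlast); apply/linkedP => j juv.
  by have -> : j = i by move: vu => /= vu; apply: val_inj => /=; lia.
wlog vw : v w / v <= w.
  move=> hw; have [|/ltnW wv] := leqP v w; first exact: hw.
  rewrite linked_sym => /(hw _ _ wv).
  rewrite sym_connect_sym // => a b; apply: eq_existsb => i; by rewrite orbC.
have [d] := ubnP (w - v); elim: d v vw => // d IH v vw dvw.
have [->|vNw] := eqVneq v w; first by rewrite connect0.
have {vNw} vltw : v < w by rewrite ltn_neqAle vw andbT.
have vk : v < k by have := ltn_ord w; lia.
have v1k : v.+1 < k.+1 by [].
move=> /linkedP lvw; apply: (@connect_trans _ _ (Ordinal v1k)).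
  apply: connect1; apply/existsP; exists (Ordinal vk).
  by rewrite lvw /= ?eqxx //; lia.
apply: IH => /=; [lia|lia|].
by apply/linkedP => i /= ?; apply: lvw; lia.
Qed.

Lemma vertsP G v :
  reflect (exists2 i : 'I_k, i \in G & (v == i :> nat) || (v == i.+1 :> nat))
          (v \in verts G).
Proof. by rewrite inE; exact: exists_inP. Qed.

Lemma verts_sub G H : H \subset G -> verts H \subset verts G.
Proof.
move=> HG; apply/subsetP => v /vertsP[i iH vi].
by apply/vertsP; exists i => //; exact: (subsetP HG).
Qed.

Lemma vertsU G H : verts (G :|: H) = verts G :|: verts H.
Proof.
apply/setP => v; apply/vertsP/setUP => [[i]|[] /vertsP[i iG vi]]; last 2 first.
- by exists i => //; rewrite inE iG.
- by exists i => //; rewrite inE iG orbT.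
by rewrite inE => /orP[] iG vi; [left|right]; apply/vertsP; exists i.
Qed.

Lemma verts1_card (i : 'I_k) : #|verts [set i]| = 2.
Proof.
have ik1 : i < k.+1 by rewrite ltnW // ltnS.
have i1k1 : i.+1 < k.+1 by rewrite ltnS.
have -> : verts [set i] = [set Ordinal ik1; Ordinal i1k1].
  apply/setP => v; rewrite !inE -!val_eqE /=; apply/exists_inP/idP => [[j]|h].
    by rewrite inE => /eqP ->.
  by exists i => //; rewrite inE.
by rewrite cards2 -val_eqE /= neq_ltn ltnSn.
Qed.

(** The component of [v]; junk value [[set v]] when [v] is not a vertex of [G]. *)
Definition component G v : {set 'I_k.+1} := [set w | linked G v w].

Lemma mem_component G v : v \in component G v.
Proof. by rewrite inE linkedxx. Qed.

Lemma linked_verts G v w : v \in verts G -> linked G v w -> w \in verts G.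
Proof.
move=> vG /linkedP lvw; have [<- //|] := eqVneq v w.
rewrite -val_eqE neq_ltn /= => /orP[] ltn.
  have wk : w.-1 < k by have := ltn_ord w; lia.
  by apply/vertsP; exists (Ordinal wk); [apply: lvw|] => /=; lia.
have wk : w < k by have := ltn_ord v; lia.
by apply/vertsP; exists (Ordinal wk); [apply: lvw|] => /=; lia.
Qed.

Lemma componentsP G X :
  reflect (exists2 v, v \in verts G & X = component G v) (X \in components G).
Proof.
have E v : v \in verts G -> [set w in verts G | connect (adj G) v w] = component G v.
  move=> vG; apply/setP => w; rewrite in_set [in RHS]in_set connect_adjE.
  by apply/andP/idP => [[] //|lvw]; split=> //; exact: linked_verts lvw.
by apply: (iffP imsetP) => -[v vG ->]; exists v; rewrite ?E.
Qed.

Lemma component_components G v : v \in verts G -> component G v \in components G.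
Proof. by move=> vG; apply/componentsP; exists v. Qed.

Lemma component_eq G v w : w \in component G v -> component G w = component G v.
Proof.
rewrite inE => lvw; apply/setP => x; rewrite !inE.
by apply/idP/idP; apply: linked_trans; rewrite // linked_sym.
Qed.

Lemma componentE G X x : X \in components G -> x \in X -> X = component G x.
Proof. by move=> /componentsP[v _ ->] xX; rewrite (component_eq xX). Qed.

Lemma component_verts G X : X \in components G -> X \subset verts G.
Proof.
by move=> /componentsP[v vG ->]; apply/subsetP => w; rewrite inE; exact: linked_verts.
Qed.

Lemma component_neq0 G X : X \in components G -> exists x, x \in X.
Proof. by move=> /componentsP[v _ ->]; exists v; exact: mem_component. Qed.

Lemma component_subset G H v : H \subset G -> component H v \subset component G v.
Proof. by move=> HG; apply/subsetP => w; rewrite !inE; exact: linked_sub. Qed.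

Lemma sub_component G H X Z x : H \subset G -> X \in components G ->
  Z \in components H -> x \in X -> x \in Z -> Z \subset X.
Proof.
by move=> HG /componentE XE /componentE ZE xX xZ; rewrite (XE x) // (ZE x) // component_subset.
Qed.

Lemma components_disjoint G X Z : X \in components G -> Z \in components G ->
  X != Z -> [disjoint X & Z].
Proof.
move=> XG ZG XNZ; rewrite -setI_eq0; apply: contraNT XNZ => /set0Pn[x].
by rewrite inE => /andP[/(componentE XG) -> /(componentE ZG) ->].
Qed.

Definition convex Y := forall x y z, x \in Y -> z \in Y -> x <= y <= z -> y \in Y.

Lemma component_convex G X : X \in components G -> convex X.
Proof.
move=> /componentsP[v _ ->] x y z xX zX xyz; rewrite -(component_eq xX) inE.
apply: (@linked_between _ x z); [lia|lia|].
by move: zX; rewrite -(component_eq xX) inE.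
Qed.

Lemma convex_notin Y w y : convex Y -> w \notin Y -> y \in Y ->
  (forall x, x \in Y -> w < x) \/ (forall x, x \in Y -> x < w).
Proof.
move=> cY wY yY; have [wy|yw|wy] := ltngtP w y; last first.
- by move: wY; rewrite (val_inj wy) yY.
- right=> x xY; rewrite ltnNge; apply/negP => wx; move/negP: wY; apply.
  by apply: (cY y w x) => //; lia.
- left=> x xY; rewrite ltnNge; apply/negP => wx; move/negP: wY; apply.
  by apply: (cY x w y) => //; lia.
Qed.

(** An edge of [G] inside [X] would bring a vertex of [G] into [X], so [X] is connected by edges of
    [H] alone. *)
Lemma component_setU G H X : [disjoint X & verts G] ->
  X \in components (G :|: H) -> X \in components H.
Proof.
move=> XG XGH; have [x xX] := component_neq0 XGH.
have xH : x \in verts H.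
  have := subsetP (component_verts XGH) x xX; rewrite vertsU inE => /orP[] // xG.
  by have := disjointFr XG xX; rewrite xG.
suff -> : X = component H x by exact: component_components.
apply/eqP; rewrite eqEsubset {2}(componentE XGH xX) component_subset ?subsetUr // andbT.
apply/subsetP => w wX; rewrite inE; apply/linkedP => i ixw.
have : linked (G :|: H) x w by move: wX; rewrite (componentE XGH xX) inE.
move/linkedP/(_ i ixw); rewrite inE => /orP[] // iG.
have ik1 : i < k.+1 by rewrite ltnW // ltnS.
suff iX : Ordinal ik1 \in X.
  have /negP[] : Ordinal ik1 \notin verts G by rewrite (disjointFr XG iX).
  by apply/vertsP; exists i => //=; rewrite eqxx.
have [xw|/ltnW wx] := leqP x w.
  by apply: (component_convex XGH xX wX) => /=; lia.
by apply: (component_convex XGH wX xX) => /=; lia.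
Qed.

(** * Counting free components *)

Definition free_components G S := [set X in components G | [disjoint X & S]].
Definition nfree G S := #|free_components G S|.

Lemma free_componentsP G S X :
  reflect (X \in components G /\ [disjoint X & S]) (X \in free_components G S).
Proof. by rewrite inE; exact: andP. Qed.

Lemma nfree_anti G S Y : S \subset Y -> nfree G Y <= nfree G S.
Proof.
move=> SY; apply: subset_leq_card; apply/subsetP => X; rewrite !inE => /andP[-> /=].
by apply: disjointWr.
Qed.

Lemma nfree_setU G H S : nfree (G :|: H) (S :|: verts G) <= nfree H (S :|: verts G).
Proof.
apply: subset_leq_card; apply/subsetP => X; rewrite !inE => /andP[XGH XS].
rewrite XS andbT; apply: component_setU XGH.
by apply: disjointWr XS; exact: subsetUr.
Qed.

Definition inner_components H Y := [set Z in components H | Z \subset Y].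

Lemma inner_componentsP H Y Z :
  reflect (Z \in components H /\ Z \subset Y) (Z \in inner_components H Y).
Proof. by rewrite inE; exact: andP. Qed.

(* A free component of [G] either contains a component of [H], or misses
   [verts H]; the components of [H] inside [Y] come in addition. *)
Lemma nfree_sub G H S Y : H \subset G ->
  nfree G (S :|: Y) + #|[set Z in inner_components H Y | [disjoint Z & S]]|
    <= nfree H S + nfree G (S :|: verts H :|: Y).
Proof.
move=> HG; pose M := [set X in free_components G (S :|: Y) | [disjoint X & verts H]].
have -> : nfree G (S :|: Y) = #|M| + #|free_components G (S :|: Y) :\: M|.
  rewrite /nfree -[LHS](cardsID M); congr (#|pred_of_set _| + _).
  by apply/setIidPr/subsetP => X; rewrite inE => /andP[].
rewrite -addnA addnC leq_add //; last first.
  apply: subset_leq_card; apply/subsetP => X; rewrite !inE.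
  by rewrite !disjoint_setUr => /andP[/andP[-> /andP[-> ->]] ->].
pose f X := if [pick x in X :&: verts H] is Some x then component H x else set0.
have fP X : X \in free_components G (S :|: Y) :\: M ->
    exists x, [/\ x \in X, x \in verts H & f X = component H x].
  rewrite !inE => /andP[]; case: (X \in components G) => //=.
  case: [disjoint X & S :|: Y] => //= nd _.
  rewrite /f; case: pickP => [x|none]; first by rewrite inE => /andP[xX xH]; exists x.
  by case/negP: nd; rewrite -setI_eq0; apply/set0Pn => -[x]; rewrite none.
rewrite -(card_in_imset (f := f)) => [|X X' XM X'M].
- rewrite -cardsUI addnC; apply: leq_trans (_ : 0 + #|free_components H S| <= _); last by [].
  apply: leq_add.
    rewrite leqn0 cards_eq0; apply/eqP/setP => Z; rewrite [in RHS]inE.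
    apply/negP; rewrite inE => /andP[/imsetP[X XM ->]].
    have [x [xX xH ->]] := fP X XM; rewrite !inE => /andP[/andP[_ /subsetP/(_ x)]].
    move: XM; rewrite !inE => /andP[_ /andP[_ XSY]].
    rewrite linkedxx => /(_ isT) xY _.
    by have := disjointFr XSY xX; rewrite inE xY orbT.
  apply: subset_leq_card; apply/subsetP => Z; rewrite inE => /orP[/imsetP[X XM ->]|].
    have [x [xX xH ->]] := fP X XM; rewrite inE component_components //=.
    move: XM; rewrite !inE => /andP[_ /andP[XG XSY]].
    apply: disjointWl (disjointWr (subsetUl S Y) XSY).
    by rewrite (componentE XG xX) component_subset.
  by rewrite !inE => /andP[/andP[-> _]].
- have [x [xX xH ->]] := fP X XM; have [x' [x'X x'H ->]] := fP X' X'M => cc.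
  have XG : X \in components G by move: XM; rewrite !inE => /andP[_ /andP[]].
  have X'G : X' \in components G by move: X'M; rewrite !inE => /andP[_ /andP[]].
  have : component H x \subset X' by rewrite cc (componentE X'G x'X) component_subset.
  move=> /subsetP/(_ x (mem_component H x)) xX'.
  by rewrite (componentE XG xX) (componentE X'G xX').
Qed.

Lemma nfree_sub0 G H S : H \subset G ->
  (nfree G S <= nfree H S + nfree G (S :|: verts H)).
Proof.
move=> HG; have := nfree_sub S set0 HG; rewrite !setU0; apply: leq_trans.
exact: leq_addr.
Qed.

Lemma nfree_sub_inner G H S Y : H \subset G -> [disjoint Y & S] ->
  (nfree G (S :|: Y) + #|inner_components H Y| <= nfree H S + nfree G (S :|: verts H :|: Y)).
Proof.
move=> HG YS; apply: leq_trans (nfree_sub S Y HG); rewrite leq_add2l.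
apply: subset_leq_card; apply/subsetP => Z ZP; rewrite inE ZP /=.
by move/inner_componentsP: ZP => [_ ZY]; exact: disjointWl YS.
Qed.

Lemma nfree1 G S y : (nfree G S <= (nfree G (S :|: [set y])).+1).
Proof.
rewrite /nfree (cardsD1 (component G y) (free_components G S)).
apply: (@leq_add _ _ 1); first by case: (_ \in _).
apply: subset_leq_card; apply/subsetP => X; rewrite !inE => /andP[XC /andP[XG XS]].
rewrite XG disjoint_setUr XS /= disjoint_sym disjoints1.
by apply: contra XC => yX; rewrite (componentE XG yX).
Qed.

Lemma leaf_linked (i : 'I_k) x y :
  x \in verts [set i] -> y \in verts [set i] -> linked [set i] x y.
Proof.
move=> /vertsP[j] /set1P -> hx /vertsP[j'] /set1P -> hy; apply/linkedP => l ?.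
by rewrite inE; apply/eqP/val_inj => /=; lia.
Qed.

(** * Segments and the pieces that a subgraph leaves in them *)

Definition segment G Y := convex Y /\ exists2 X, X \in components G & Y \subset X.

Lemma segment_verts G Y : segment G Y -> Y \subset verts G.
Proof. by move=> [_ [X XG YX]]; exact: subset_trans (component_verts XG). Qed.

Lemma segment_linked G Y x y : segment G Y -> x \in Y -> y \in Y -> linked G x y.
Proof.
move=> [_ [X XG /subsetP YX]] /YX xX /YX yX.
by move: yX; rewrite (componentE XG xX) inE.
Qed.

Lemma segmentI G Y x : convex Y -> x \in verts G ->
  (forall y, y \in Y -> linked G x y) -> segment G Y.
Proof.
move=> cY xG h; split=> //; exists (component G x); first exact: component_components.
by apply/subsetP => y /h; rewrite inE.
Qed.

Definition attached H Y O :=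
  [set y in Y | (y \in verts H) && ~~ [disjoint component H y & O]].

(** Makes the runs that leave [Y] on one side nested: of two runs joining [Y] to [O], one passes
    over the starting point of the other. *)
Definition one_sided Y O := forall w w' y y', w \in O -> w' \in O ->
  y \in Y -> y' \in Y ->
  (minn w' y' <= y <= maxn w' y') \/ (minn w y <= y' <= maxn w y).

Definition left_of Y := [set w : 'I_k.+1 | [forall y in Y, w < y]].
Definition right_of Y := [set w : 'I_k.+1 | [forall y in Y, y < w]].

Lemma left_ofP Y w : reflect (forall y, y \in Y -> (w < y)) (w \in left_of Y).
Proof. by rewrite inE; exact: forall_inP. Qed.

Lemma right_ofP Y w : reflect (forall y, y \in Y -> (y < w)) (w \in right_of Y).
Proof. by rewrite inE; exact: forall_inP. Qed.

Lemma left_sided Y : one_sided Y (left_of Y).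
Proof.
move=> w w' y y' /left_ofP wY /left_ofP w'Y yY y'Y.
have := wY y yY; have := wY y' y'Y; have := w'Y y yY; have := w'Y y' y'Y; lia.
Qed.

Lemma right_sided Y : one_sided Y (right_of Y).
Proof.
move=> w w' y y' /right_ofP wY /right_ofP w'Y yY y'Y.
have := wY y yY; have := wY y' y'Y; have := w'Y y yY; have := w'Y y' y'Y; lia.
Qed.

Lemma left_disjoint Y : [disjoint left_of Y & Y].
Proof.
by apply/negPn/negP => /meetP[w /left_ofP wY /wY]; rewrite ltnn.
Qed.

Lemma right_disjoint Y : [disjoint right_of Y & Y].
Proof.
by apply/negPn/negP => /meetP[w /right_ofP wY /wY]; rewrite ltnn.
Qed.

Lemma attachedP H Y O y :
  reflect ([/\ y \in Y, y \in verts H & exists2 w, w \in O & linked H y w])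
          (y \in attached H Y O).
Proof.
rewrite [X in reflect _ X]in_set; apply: (iffP idP) => [/andP[yY /andP[yH]]|[yY yH [w wO yw]]].
  by move=> /meetP[w]; rewrite inE => yw wO; split=> //; exists w.
by rewrite yY yH /=; apply/meetP; exists w; rewrite ?inE.
Qed.

Lemma attached_segment H Y O : convex Y -> one_sided Y O ->
  (exists y, y \in attached H Y O) -> segment H (attached H Y O).
Proof.
move=> cY sO [x xA]; have lk u u' : u \in attached H Y O -> u' \in attached H Y O ->
    linked H u u'.
  move=> /attachedP[uY _ [w wO uw]] /attachedP[u'Y _ [w' w'O u'w']].
  have [h|h] := sO w w' u u' wO w'O uY u'Y.
    by apply: linked_between u'w'; lia.
  by apply: linked_between uw; lia.
apply: (@segmentI _ _ x) => [u y u' uA u'A uyu'||y yA]; last exact: lk.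
- have /attachedP[uY uH [w wO uw]] := uA; have /attachedP[u'Y _ _] := u'A.
  have uy : linked H u y by apply: linked_between (lk u u' uA u'A); lia.
  apply/attachedP; split; first exact: (cY u y u').
    exact: linked_verts uy.
  by exists w => //; apply: linked_trans uw; rewrite linked_sym.
- by have /attachedP[] := xA.
Qed.

(** A component meeting the attached part reaches [O], hence leaves [Y]. *)
Lemma attached_inner H Y O Z : [disjoint O & Y] -> Z \in inner_components H Y ->
  [disjoint Z & attached H Y O].
Proof.
move=> OY /inner_componentsP[ZH /subsetP ZY].
apply/negPn/negP => /meetP[z zZ /attachedP[_ _ [w wO zw]]].
have wZ : w \in Z by rewrite (componentE ZH zZ) inE.
by have := disjointFr OY wO; rewrite ZY.
Qed.

(** The gaps that [H] leaves in [Y] are told apart by the number of components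
    inside [Y] on their left. *)
Definition inner_left H Y y :=
  [set Z in inner_components H Y | [forall z in Z, z < y]].

Lemma inner_leftP H Y y Z :
  reflect (Z \in inner_components H Y /\ forall z, z \in Z -> (z < y))
          (Z \in inner_left H Y y).
Proof.
rewrite [X in reflect _ X]in_set; apply: (iffP idP) => [/andP[ZI /forall_inP]|[-> h]] //.
exact/forall_inP.
Qed.

Definition gap H Y j := [set y in Y :\: verts H | #|inner_left H Y y| == j].

Lemma gapP H Y j y :
  reflect [/\ y \in Y, y \notin verts H & #|inner_left H Y y| = j] (y \in gap H Y j).
Proof.
rewrite [X in reflect _ X]in_set; apply: (iffP idP).
  by move=> /andP[/setDP[yY yH] /eqP].
by move=> [yY yH /eqP ->]; rewrite andbT; apply/setDP.
Qed.

(** If [y] were a vertex of [H], its component would be trapped between [x] and [z], hence inside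
    [Y], and would be counted for [z] but not for [x]. *)
Lemma gap_between H Y j x y z : convex Y -> x \in gap H Y j -> z \in gap H Y j ->
  (x <= y <= z) -> y \in gap H Y j.
Proof.
move=> cY /gapP[xY xH jx] /gapP[zY zH jz] xyz; pose I := inner_left H Y.
have Isub u u' : (u <= u') -> I u \subset I u'.
  move=> uu'; apply/subsetP => Z /inner_leftP[ZI h].
  by apply/inner_leftP; split=> // z' /h/leq_trans; apply.
have [lexy leyz] := andP xyz; have yY : y \in Y by exact: (cY x y z).
have [xy yz] : I x \subset I y /\ I y \subset I z by split; exact: Isub.
have yj : #|I y| = j.
  apply/eqP; rewrite eqn_leq; apply/andP; split.
    by rewrite -jz; exact: subset_leq_card.
  by rewrite -[in X in (X <= _)]jx; exact: subset_leq_card.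
have yH : y \notin verts H.
  apply/negP => yH; pose Z := component H y.
  have ZH : Z \in components H by exact: component_components.
  have cZ := component_convex ZH; have yZ : y \in Z by exact: mem_component.
  have xZ : x \notin Z by apply: contra xH; exact: (subsetP (component_verts ZH)).
  have zZ : z \notin Z by apply: contra zH; exact: (subsetP (component_verts ZH)).
  have Zx u : u \in Z -> (x < u).
    by case: (convex_notin cZ xZ yZ) => h; [exact: h|have := h y yZ; rewrite ltnNge lexy].
  have Zz u : u \in Z -> (u < z).
    by case: (convex_notin cZ zZ yZ) => h; [have := h y yZ; rewrite ltnNge leyz|exact: h].
  have ZI : Z \in I z.
    apply/inner_leftP; split=> //; apply/inner_componentsP; split=> //.
    by apply/subsetP => u uZ; apply: (cY x u z) => //; rewrite (ltnW (Zx u uZ)) (ltnW (Zz u uZ)).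
  have ZnI : Z \notin I x.
    by apply/negP => /inner_leftP[_ /(_ y yZ)]; rewrite ltnNge lexy.
  have : I x == I z by rewrite eqEcard (subset_trans xy yz) /I jz jx /=.
  by move/eqP => E; rewrite E ZI in ZnI.
by apply/gapP.
Qed.

(** * Missing edges and pinned segments *)

Implicit Types (A B : {set 'I_k}) (e f i : 'I_k).

Definition src i : 'I_k.+1 := widen_ord (leqnSn k) i.
Definition tgt i : 'I_k.+1 := lift ord0 i.

Lemma src_val i : src i = i :> nat. Proof. by []. Qed.
Lemma tgt_val i : tgt i = i.+1 :> nat. Proof. exact: lift0. Qed.

Lemma src_verts G i : i \in G -> src i \in verts G.
Proof. by move=> iG; apply/vertsP; exists i; rewrite ?src_val ?eqxx. Qed.

Lemma tgt_verts G i : i \in G -> tgt i \in verts G.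
Proof. by move=> iG; apply/vertsP; exists i; rewrite ?tgt_val ?eqxx ?orbT. Qed.

(** If [H] had every edge inside [Y], then [Y] would be connected in [H]; having two vertices, it
    would lie in a component of [H]. *)
Lemma missing_edge H Y : convex Y -> (1 < #|Y|) ->
  (forall X, X \in components H -> ~~ (Y \subset X)) ->
  exists i, [/\ i \notin H, src i \in Y & tgt i \in Y].
Proof.
move=> cY /card_gt1P[y [y' [yY y'Y yy']]] hX.
have [i /and3P[? ? ?]|none] := pickP [pred i | [&& i \notin H, src i \in Y & tgt i \in Y]].
  by exists i.
have inH i z z' : z \in Y -> z' \in Y -> z <= i < z' -> i \in H.
  move=> zY z'Y izz'; have := none i; rewrite /=.
  rewrite (cY z (src i) z') // ?(cY z (tgt i) z') // ?andbT ?tgt_val ?src_val; first exact: negbFE.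
    by move: izz'; clear; lia.
  by move: izz'; clear; lia.
have lk z : z \in Y -> linked H y z.
  move=> zY; apply/linkedP => i; case: (leqP y z) => yz.
    exact: inH.
  exact: inH.
have yH : y \in verts H.
  have [yy|y'y|E] := ltngtP y y'; last by move: yy'; rewrite (val_inj E) eqxx.
    have yk : y < k by move: yy (ltn_ord y'); clear; lia.
    apply/vertsP; exists (Ordinal yk); last by rewrite /= eqxx.
    by apply: (inH _ y y') => //=; rewrite leqnn.
  have yk : y.-1 < k by move: (ltn_ord y) y'y; clear; lia.
  apply/vertsP; exists (Ordinal yk); last by move: y'y => /=; clear; lia.
  by apply: (inH _ y' y) => //=; move: y'y; clear; lia.
have /negP[] := hX _ (component_components yH).
by apply/subsetP => z zY; rewrite inE lk.
Qed.

(** In every subgraph of [H], the component of [y] cannot leave [Y] without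
    containing [Y]: the edge of [G] at one end of [Y] is absent from [H]. *)
Definition pinned H Y y := forall H', H' \subset H -> y \in verts H' ->
  component H' y \subset Y \/ Y \subset component H' y.

Definition pinned_segment H Y := segment H Y /\ exists2 y, y \in Y & pinned H Y y.

Lemma inner_components0 H Y v : inner_components H Y = set0 -> v \in verts H ->
  exists2 w, linked H v w & w \notin Y.
Proof.
move=> i0 vH; have /subsetPn[w] : ~~ (component H v \subset Y).
  apply/negP => vY; have : component H v \in inner_components H Y.
    by apply/inner_componentsP; split=> //; exact: component_components.
  by rewrite i0 inE.
by rewrite inE; exists w.
Qed.

(* No component of [A] or of [B] lies inside [Y], so near an edge missing from
   [A] the run of [B] reaches an end of [Y], and conversely. *)
Lemma overlap_split A B Y e f : segment (A :|: B) Y ->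
  inner_components A Y = set0 -> inner_components B Y = set0 ->
  src e \in Y -> tgt f \in Y -> e < f -> e \notin A -> f \notin B ->
  exists Y1 Y2, [/\ pinned_segment B Y1, pinned_segment A Y2, Y1 \subset Y, Y2 \subset Y
    & #|Y| <= #|Y1| + #|Y2|].
Proof.
move=> sY iA iB eY fY ef eA fB; have cY := sY.1.
have edgeY i u v : u \in Y -> v \in Y -> u <= i < v -> i \in A :|: B.
  move=> uY vY uiv; apply: (linkedP _ _ _ (segment_linked sY uY vY)).
  by move: uiv; clear; lia.
(* [f1] is the first edge after [e] missing from [B], and [e1] the last edge before [f1] missing
   from [A]. So [B] has all edges strictly between [e] and [f1], and [A] all those strictly between
   [e1] and [f1]. *)
pose Pf (i : 'I_k) := (i \notin B) && (e < i).
have Pf0 : Pf f by rewrite /Pf fB.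
case: (@arg_minnP _ f Pf (fun i => i : nat) Pf0) => f1 /andP[f1B ef1] fmin.
have f1f : f1 <= f := fmin f Pf0.
have {}fmin i : e < i < f1 -> i \in B.
  move=> /andP[ei if1]; apply: contraTT if1 => iB'; rewrite -leqNgt.
  by apply: fmin; rewrite /Pf iB'.
pose Pe (i : 'I_k) := (i \notin A) && (i < f1).
have Pe0 : Pe e by rewrite /Pe eA.
case: (@arg_maxnP _ e Pe (fun i => i : nat) Pe0) => e1 /andP[e1A e1f1] emax.
have ee1 : e <= e1 := emax e Pe0.
have {}emax i : e1 < i < f1 -> i \in A.
  move=> /andP[ei if1]; apply: contraTT ei => iA'; rewrite -leqNgt.
  by apply: emax; rewrite /Pe iA'.
have inY v : e <= v <= f.+1 -> v \in Y.
  by move=> h; apply: (cY (src e) v (tgt f)) => //; rewrite tgt_val.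
have f1Y : src f1 \in Y by apply: inY; rewrite src_val; move: ef1 f1f; clear; lia.
have f1Y' : tgt f1 \in Y by apply: inY; rewrite tgt_val; move: ef1 f1f; clear; lia.
have e1Y : src e1 \in Y by apply: inY; rewrite src_val; move: ee1 e1f1 f1f; clear; lia.
have e1Y' : tgt e1 \in Y by apply: inY; rewrite tgt_val; move: ee1 e1f1 f1f; clear; lia.
have eB : e \in B.
  have : e \in A :|: B.
    apply: (edgeY e (src e) (src f1)) => //; rewrite !src_val; move: ef1; clear; lia.
  by rewrite inE (negbTE eA).
have f1A : f1 \in A.
  have : f1 \in A :|: B.
    apply: (edgeY f1 (src f1) (tgt f1)) => //; rewrite src_val tgt_val; clear; lia.
  by rewrite inE (negbTE f1B) orbF.
(* [Y1] ends at the source of [f1] and [Y2] begins at the target of [e1]; they cover [Y] because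
   [e1 < f1]. The absent edges block these ends, so a run that starts there and leaves the piece
   must cross all of it. *)
pose Y1 := [set y in Y | y <= f1]; pose Y2 := [set y in Y | e1 < y].
have Y1P y : y \in Y1 -> y \in Y /\ y <= f1 by rewrite inE => /andP[].
have Y2P y : y \in Y2 -> y \in Y /\ e1 < y by rewrite inE => /andP[].
exists Y1, Y2; split.
- split.
    have [w lw wY] := inner_components0 iB (src_verts eB).
    have wltY : forall y, y \in Y -> w < y.
      case: (convex_notin cY wY eY) => // h; case/negP: f1B.
      apply: (linkedP _ _ _ lw); have := h _ f1Y'; rewrite tgt_val src_val.
      by move: ef1; clear; lia.
    apply: (@segmentI _ _ (src e)).
    + move=> x y z /Y1P[xY _] /Y1P[zY zf] xyz; rewrite inE (cY x y z) //=.
      by move: xyz zf; clear; lia.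
    + exact: src_verts.
    move=> y /Y1P[yY yf]; apply/linkedP => i; rewrite src_val => hi.
    have [ie|ei|/val_inj -> //] := ltngtP i e; last by apply: fmin; move: hi yf ei; clear; lia.
    apply: (linkedP _ _ _ lw); rewrite src_val; have := wltY y yY.
    by move: hi ie; clear; lia.
  exists (src f1); first by rewrite inE f1Y src_val /=.
  move=> H' H'B f1H'; have [//|/subsetPn[w]] := boolP (component H' (src f1) \subset Y1); first by left.
  rewrite inE => lw wY1; right.
  have wf1 : w <= f1.
    rewrite leqNgt; apply/negP => h; case/negP: f1B; apply: (subsetP H'B).
    by apply: (linkedP _ _ _ lw); rewrite src_val; move: h; clear; lia.
  have wY : w \notin Y by apply: contra wY1 => wY; rewrite inE wY.
  have wltY : forall y, y \in Y -> w < y.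
    by case: (convex_notin cY wY f1Y) => // h; have := h _ f1Y; rewrite src_val ltnNge wf1.
  apply/subsetP => y /Y1P[/wltY wy yf]; rewrite inE; apply: linked_between lw;
    by rewrite src_val; move: wy yf wf1; clear; lia.
- split.
    have [w lw wY] := inner_components0 iA (tgt_verts f1A).
    have wgtY : forall y, y \in Y -> y < w.
      case: (convex_notin cY wY eY) => // h; case/negP: e1A.
      apply: (linkedP _ _ _ lw); have := h _ e1Y; rewrite tgt_val src_val.
      by move: e1f1; clear; lia.
    apply: (@segmentI _ _ (tgt f1)).
    + move=> x y z /Y2P[xY ex] /Y2P[zY _] xyz; rewrite inE (cY x y z) //=.
      by move: xyz ex; clear; lia.
    + exact: tgt_verts.
    move=> y /Y2P[yY ey]; apply/linkedP => i; rewrite tgt_val => hi.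
    have [iF|Fi|/val_inj -> //] := ltngtP i f1; first by apply: emax; move: hi ey iF; clear; lia.
    apply: (linkedP _ _ _ lw); rewrite tgt_val; have := wgtY y yY.
    by move: hi Fi; clear; lia.
  exists (tgt e1); first by rewrite inE e1Y' tgt_val /=.
  move=> H' H'A e1H'; have [//|/subsetPn[w]] := boolP (component H' (tgt e1) \subset Y2); first by left.
  rewrite inE => lw wY2; right.
  have ew : e1 < w.
    rewrite ltnNge; apply/negP => h; case/negP: e1A; apply: (subsetP H'A).
    by apply: (linkedP _ _ _ lw); rewrite tgt_val; move: h; clear; lia.
  have wY : w \notin Y by apply: contra wY2 => wY; rewrite inE wY.
  have wgtY : forall y, y \in Y -> y < w.
    by case: (convex_notin cY wY e1Y') => // h; have := h _ e1Y'; rewrite tgt_val ltnNge ew.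
  apply/subsetP => y /Y2P[/wgtY wy ey]; rewrite inE; apply: linked_between lw;
    by rewrite tgt_val; move: wy ey ew; clear; lia.
- by apply/subsetP => y /Y1P[].
- by apply/subsetP => y /Y2P[].
have YU : Y \subset Y1 :|: Y2.
  apply/subsetP => y yY; rewrite !inE yY /=.
  by move: e1f1; clear; lia.
by apply: leq_trans (subset_leq_card YU) _; exact: leq_card_setU.
Qed.

Lemma nfree_component G S X : X \in components G -> (nfree G S <= (nfree G (S :|: X)).+1).
Proof.
move=> XG; rewrite /nfree (cardsD1 X (free_components G S)).
apply: (@leq_add _ _ 1); first by case: (_ \in _).
apply: subset_leq_card; apply/subsetP => X' /setD1P[XX' /free_componentsP[X'G X'S]].
apply/free_componentsP; split=> //; rewrite disjoint_setUr X'S.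
exact: components_disjoint X'G XG XX'.
Qed.

(** The two sides of [Z] share at least half of the vertices of [X]; the longer side is chosen. *)
Lemma side_segment G X Z : X \in components G -> convex Z -> Z \subset X ->
  (2 * #|Z| <= #|X|) ->
  exists Y, [/\ segment G Y, Y \subset X, [disjoint Y & Z] & (#|X| <= 4 * #|Y|)].
Proof.
move=> XG cZ ZX ZX2; have cX := component_convex XG.
pose Y1 := X :&: left_of Z; pose Y2 := X :&: right_of Z.
have s1 : segment G Y1.
  split; last by exists X => //; exact: subsetIl.
  move=> x y z /setIP[xX _] /setIP[zX /left_ofP zZ] /andP[xy yz].
  apply/setIP; split; first by apply: (cX x y z) => //; rewrite xy.
  by apply/left_ofP => u /zZ; exact: leq_ltn_trans.
have s2 : segment G Y2.
  split; last by exists X => //; exact: subsetIl.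
  move=> x y z /setIP[xX /right_ofP xZ] /setIP[zX _] /andP[xy yz].
  apply/setIP; split; first by apply: (cX x y z) => //; rewrite xy.
  by apply/right_ofP => u /xZ ux; exact: leq_trans ux xy.
have card12 : (#|X| <= #|Z| + (#|Y1| + #|Y2|)).
  rewrite -(cardsID Z X) (setIidPr ZX) leq_add2l.
  apply: leq_trans (leq_card_setU _ _); apply: subset_leq_card.
  have [Z0|[z zZ]] := set_0Vmem Z.
    apply/subsetP => x /setDP[xX _]; apply/setUP; left; apply/setIP; split=> //.
    by apply/left_ofP => u; rewrite Z0 inE.
  apply/subsetP => x /setDP[xX xZ]; apply/setUP.
  by case: (convex_notin cZ xZ zZ) => h; [left|right]; apply/setIP; split=> //;
    [apply/left_ofP|apply/right_ofP].
have [Y12|Y12] := leqP #|Y1| #|Y2|.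
  exists Y2; split=> //; [exact: subsetIl| |by move: card12 ZX2 Y12; clear; lia].
  by apply: disjointWl (right_disjoint Z); exact: subsetIr.
exists Y1; split=> //; [exact: subsetIl| |by move: card12 ZX2 Y12; clear; lia].
by apply: disjointWl (left_disjoint Z); exact: subsetIr.
Qed.

End PathGraphs.

Import Order.TTheory GRing.Theory Num.Theory.
Local Open Scope ring_scope.

(** * Fibers *)

Lemma card_le_fibers (R : numDomainType) (T U : finType) (f : T -> U) (A : {set T}) (M : R) :
  (forall a, a \in A -> #|[set b in A | f b == f a]|%:R <= M) ->
  #|A|%:R <= #|f @: A|%:R * M.
Proof.
move=> hM; rewrite -sum1_card natr_sum (partition_big_imset f) /=.
apply: (@le_trans _ _ (\sum_(u in f @: A) M)); last by rewrite sumr_const mulr_natl.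
apply: ler_sum => _ /imsetP[a aA ->].
rewrite -natr_sum sum1_card; apply: le_trans (hM a aA).
by rewrite ler_nat; apply: subset_leq_card; apply/subsetP => b; rewrite inE.
Qed.

Section Fibers.
Variables (n k : nat).
Implicit Types (S U V W : {set 'I_k.+1}) (A B C : {set passign n k}) (x y z b : passign n k).

Lemma assignP V b : reflect (forall v, (b v : bool) = (v \in V)) (b \in assign n V).
Proof.
by rewrite inE; apply: (iffP forallP) => h v; [apply/eqP|apply/eqP]; rewrite ?h //; exact/eqP.
Qed.

Lemma assign_in V b v : b \in assign n V -> v \in V -> b v.
Proof. by move=> /assignP ->. Qed.

Lemma assign_notin V b v : b \in assign n V -> v \notin V -> b v = None.
Proof. by move=> /assignP/(_ v); case: (b v) => // a <-. Qed.

Lemma card_assign V : #|assign n V| = (n ^ #|V|)%N.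
Proof.
pose F (v : 'I_k.+1) : pred (option 'I_n) := if v \in V then isSome else pred1 None.
have -> : #|assign n V| = #|family F|.
  apply: eq_card => b; apply/assignP/familyP => h v; have := h v; rewrite /F;
  by case: ifP => _; rewrite /in_mem /=; case: (b v).
rewrite card_family foldrE big_map big_enum /= -prod_nat_const [RHS]big_mkcond /=.
apply: eq_bigr => v _; rewrite /F.
case: ifP => _; last by rewrite card1.
have -> : #|@isSome 'I_n| = #|predC1 (@None 'I_n)| by apply: eq_card => -[].
by rewrite cardC1 card_option card_ord.
Qed.

Lemma restr_id V b : b \in assign n V -> restr V b = b.
Proof.
move=> /assignP bV; apply/ffunP => v; rewrite ffunE -bV.
by case: (b v).
Qed.

Lemma restr_restr U V b : U \subset V -> restr U (restr V b) = restr U b.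
Proof.
move=> /subsetP UV; apply/ffunP => v; rewrite !ffunE.
by case: ifP => // /UV ->.
Qed.

Lemma restr_eqP U x y :
  reflect (forall v, v \in U -> x v = y v) (restr U x == restr U y).
Proof.
apply: (iffP eqP) => [/ffunP h v vU|h]; first by have := h v; rewrite !ffunE vU.
by apply/ffunP => v; rewrite !ffunE; case: ifP => // /h.
Qed.

(** [S] need not be contained in the domain of [b]. *)
Definition agrees S z b := [forall v in S, (b v == None) || (b v == z v)].
Definition fiber S z B := [set b in B | agrees S z b].

Lemma agreesP S z b :
  reflect (forall v, v \in S -> b v -> b v = z v) (agrees S z b).
Proof.
apply: (iffP forall_inP) => h v vS.
  by have := h v vS; case: (b v) => [a|] //= /eqP.
by have := h v vS; case: (b v) => [a|] //= /(_ isT) ->.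
Qed.

Lemma fiberP S z B b : reflect (b \in B /\ agrees S z b) (b \in fiber S z B).
Proof. by rewrite inE; exact: andP. Qed.

Lemma agrees_restr S U z b : agrees S z b -> agrees S z (restr U b).
Proof. by move=> /agreesP h; apply/agreesP => v vS; rewrite ffunE; case: ifP => // _; exact: h. Qed.

Lemma card_restr_fiber V U S z B : B \subset assign n V -> U \subset V ->
  (#|restr U @: fiber S z B| <= n ^ #|U :\: S|)%N.
Proof.
move=> /subsetP BV UV; rewrite -card_assign.
rewrite -(card_in_imset (f := restr (U :\: S))) => [|x y]; last first.
  move=> /imsetP[b /fiberP[bB /agreesP bz] ->] /imsetP[c /fiberP[cB /agreesP cz] ->].
  rewrite !restr_restr ?subsetDl // => /eqP/restr_eqP bc; apply/eqP/restr_eqP => v vU.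
  have [vS|vS] := boolP (v \in S); last by apply: bc; rewrite inE vS.
  have vV := subsetP UV v vU.
  by rewrite (bz v vS (assign_in (BV b bB) vV)) (cz v vS (assign_in (BV c cB) vV)).
apply: subset_leq_card; apply/subsetP => _ /imsetP[_ /imsetP[b /fiberP[bB _] ->] ->].
rewrite restr_restr ?subsetDl //; apply: restr_assign (BV b bB) _.
exact: subset_trans (subsetDl _ _) UV.
Qed.

Lemma card_fiber V S z B : B \subset assign n V ->
  (#|fiber S z B| <= n ^ #|V :\: S|)%N.
Proof.
move=> BV; apply: leq_trans (card_restr_fiber S z BV (subxx V)).
rewrite (card_in_imset (f := restr V)) // => x y /fiberP[xB _] /fiberP[yB _].
by rewrite !restr_id // (subsetP BV).
Qed.

Section Reals.
Variable R : realType.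

(** A member of the join is counted by its restriction to [V], which lies in the fiber of [B], and
    then by its restriction to [W], which lies in a fiber of [C] with the coordinates in [S] and [V]
    fixed. *)
Lemma card_join_fiber V W S z B C (M1 M2 : R) :
  #|fiber S z B|%:R <= M1 ->
  (forall z', #|fiber (S :|: V) z' C|%:R <= M2) ->
  #|fiber S z (join V W B C)|%:R <= M1 * M2.
Proof.
move=> hB hC; apply: (@le_trans _ _ (#|restr V @: fiber S z (join V W B C)|%:R * M2)); last first.
  apply: ler_wpM2r; first by apply: le_trans (hC z).
  apply: le_trans hB; rewrite ler_nat; apply: subset_leq_card.
  apply/subsetP => _ /imsetP[b /fiberP[bj bz] ->].
  move: bj; rewrite inE => /and3P[_ bB _].
  by apply/fiberP; split=> //; exact: agrees_restr.
apply: card_le_fibers => a /fiberP[aA az]; apply: le_trans (hC a).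
have inj b : b \in join V W B C -> b \in assign n (V :|: W) by rewrite inE => /andP[].
set F := [set b in _ | _].
have FP b : b \in F -> [/\ b \in join V W B C, agrees S z b & forall v, v \in V -> b v = a v].
  by rewrite inE => /andP[/fiberP[bA bz]] /restr_eqP ba.
rewrite ler_nat -(card_in_imset (f := restr W)) => [|x y /FP[xA _ xa] /FP[yA _ ya] /eqP/restr_eqP xy].
  apply: subset_leq_card; apply/subsetP => _ /imsetP[b /FP[bA bz ba] ->].
  apply/fiberP; split; first by move: bA; rewrite inE => /and3P[].
  apply/agrees_restr/agreesP => v; rewrite inE => /orP[vS|/ba //] bv.
  have av : a v.
    by apply: (assign_in (inj a aA)); rewrite -(assignP _ _ (inj b bA)).
  by rewrite (agreesP _ _ _ bz v vS bv) (agreesP _ _ _ az v vS av).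
apply/ffunP => v; have [vV|vV] := boolP (v \in V); first by rewrite xa // ya.
have [vW|vW] := boolP (v \in W); first exact: xy.
have vVW : v \notin V :|: W by rewrite inE negb_or vV.
by rewrite (assign_notin (inj x xA) vVW) (assign_notin (inj y yA) vVW).
Qed.

End Reals.
End Fibers.

(** * Join trees *)

Inductive jtree k := Leaf of 'I_k | Node of jtree k & jtree k.

Section JoinTrees.
Variable k : nat.

Fixpoint edges (T : jtree k) : {set 'I_k} :=
  match T with Leaf i => [set i] | Node a b => edges a :|: edges b end.

Fixpoint subtree (t T : jtree k) : Prop :=
  t = T \/ if T is Node a b then subtree t a \/ subtree t b else False.

Lemma subtree_refl T : subtree T T.
Proof. by case: T; left. Qed.

Lemma subtree_edges t T : subtree t T -> edges t \subset edges T.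
Proof.
elim: T => [i|a IHa b IHb] /= [->//|] // [/IHa|/IHb] h; apply: subset_trans h _;
  [exact: subsetUl|exact: subsetUr].
Qed.

Implicit Types c d T : jtree k.

(** Symmetric in [c] and [d], so that a step into a child is argued once for both sides. *)
Definition children c d T := T = Node c d \/ T = Node d c.

Lemma children_edges c d T : children c d T -> edges T = edges c :|: edges d.
Proof. by move=> [->//|->]; rewrite /= setUC. Qed.

Lemma children_sub c d T : children c d T -> edges c \subset edges T.
Proof. by move=> /children_edges ->; exact: subsetUl. Qed.

Lemma children_verts c d T : children c d T ->
  verts (edges T) = verts (edges c) :|: verts (edges d).
Proof. by move=> /children_edges ->; exact: vertsU. Qed.

Lemma children_sym c d T : children c d T -> children d c T.
Proof. by case; [right|left]. Qed.

End JoinTrees.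

HB.instance Definition _ k := gen_eqMixin (jtree k).

(** * Counting join patterns *)

Section Patterns.
Variable k : nat.
Implicit Types (G H K : {set 'I_k}) (T a b : jtree k).

(** The edge bound stands for properness: a proper subgraph of a graph with at most [f.+1] edges has
    at most [f]. *)
Definition splittings f G := [set HK in setX (powerset G) (powerset G) |
  (#|HK.1| <= f) && (#|HK.2| <= f)]%N.

Fixpoint patterns f G : seq (jtree k) :=
  if f is f'.+1 then
    if #|G| == 1%N then [seq Leaf i | i <- enum G]
    else flatten [seq [seq Node a b | a <- patterns f' HK.1, b <- patterns f' HK.2]
                 | HK <- enum (splittings f' G)]
  else [::].

Fixpoint npatterns f : nat :=
  if f is f'.+1 then (4 ^ f * npatterns f' ^ 2)%N else 1%N.

Lemma npatterns_gt0 f : (0 < npatterns f)%N.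
Proof. by elim: f => //= f IH; rewrite muln_gt0 !expn_gt0 IH. Qed.

Lemma size_patterns f G : (#|G| <= f)%N -> (size (patterns f G) <= npatterns f)%N.
Proof.
elim: f G => [//|f IH] G Gf /=; have [G1|_] := eqVneq #|G| 1%N.
  rewrite size_map -cardE G1; exact: (npatterns_gt0 f.+1).
rewrite size_flatten /shape -map_comp sumnE big_map.
apply: (@leq_trans (\sum_(HK <- enum (splittings f G)) npatterns f ^ 2)).
  rewrite big_seq [X in (_ <= X)%N]big_seq; apply: leq_sum => HK.
  rewrite mem_enum inE => /andP[_ /andP[h1 h2]]; rewrite /= size_allpairs -mulnn.
  by rewrite leq_mul ?IH.
rewrite big_const_seq count_predT iter_addn_0 -cardE mulnC leq_mul2r; apply/orP; right.
apply: (@leq_trans (2 ^ #|G| * 2 ^ #|G|)%N).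
  rewrite -!card_powerset -cardsX; apply: subset_leq_card.
  by apply/subsetP => HK; rewrite inE => /andP[].
by rewrite -expnMn leq_exp2l.
Qed.

Lemma npatterns_le f : (npatterns f <= 16 ^ (2 ^ f))%N.
Proof.
(* The factor [16 * 4 ^ f] makes the induction close: squaring the left side for [f] gives exactly
   the one for [f.+1]. *)
suff : (16 * 4 ^ f * npatterns f <= 16 ^ (2 ^ f))%N.
  apply: leq_trans; by rewrite leq_pmull // muln_gt0 expn_gt0.
elim: f => [//|f IH]; have := leq_mul IH IH.
rewrite -expnD addnn -mul2n -expnS; apply: leq_trans.
rewrite [npatterns f.+1]/= -mulnn !expnS; apply: eq_leq; ring.
Qed.

End Patterns.

(** * Cost bounds *)

Section Costs.
Variables (R : realType) (n k : nat).
Hypotheses (n_gt0 : (1 <= n)%N) (k_gt1 : (2 <= k)%N).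
Implicit Types (T a b t : jtree k) (S Y : {set 'I_k.+1}) (A B C : {set passign n k}) (w : R).
Implicit Types (G H : {set 'I_k}).

(** The cube root of [ntilde] ([rho3]): potentials are counted in thirds, so that exponents of [rho]
    are natural numbers. *)
Definition rho : R := n%:R `^ ((1 - 1 / log2 k%:R) / 3).

Lemma log2k_ge1 : 1 <= log2 (k%:R : R).
Proof.
have ln2 : 0 < ln (2 : R) by rewrite ln_gt0 // ltr1n.
by rewrite /log2 ler_pdivlMr // mul1r ler_ln ?posrE ?ltr0n ?ler_nat // ltnW.
Qed.

Lemma rho3 : rho ^+ 3 = ntilde R n k.
Proof.
by rewrite /rho /ntilde -powR_mulrn ?powR_ge0 // -powRrM divfK // pnatr_eq0.
Qed.

Lemma rho_exp_ge0 : 0 <= 1 - 1 / log2 (k%:R : R).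
Proof.
have L1 := log2k_ge1; have L0 : 0 < log2 (k%:R : R) by apply: lt_le_trans L1.
by rewrite subr_ge0 ler_pdivrMr // mul1r.
Qed.

Lemma rho_ge1 : 1 <= rho.
Proof.
rewrite /rho -[leLHS](powRr0 n%:R) ler_powR ?ler1n //.
by apply: divr_ge0 => //; exact: rho_exp_ge0.
Qed.

Lemma rho_gt0 : 0 < rho. Proof. exact: lt_le_trans rho_ge1. Qed.

Lemma rho3_le : rho ^+ 3 <= n%:R.
Proof.
rewrite rho3 /ntilde -[leRHS]powRr1 ?ler0n // ler_powR ?ler1n // gerBl divr_ge0 //.
by apply: le_trans log2k_ge1.
Qed.

Lemma nR_gt0 : 0 < n%:R :> R. Proof. by rewrite ltr0n. Qed.

Lemma small_fiber_cover G C (D : {set {set 'I_k.+1}}) z :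
  small_pathset R G C -> D \subset components G ->
  #|fiber (verts G :\: cover D) z C|%:R * rho ^+ (3 * #|D|) <= n%:R ^+ #|cover D| :> R.
Proof.
move=> [CG smC] DG; have DV : cover D \subset verts G.
  by apply/bigcupsP => X /(subsetP DG)/component_verts.
(* Smallness speaks of at least one component; for none, the trivial count is enough. *)
have [D0|D0] := eqVneq #|D| 0%N.
  rewrite D0 muln0 expr0 mulr1 -natrX ler_nat; apply: leq_trans (card_fiber _ _ CG) _.
  by rewrite setDDr setDv set0U (setIidPr DV).
(* [z] need not be an assignment on [U]; a member [x0] of the fiber, restricted to [U], takes its
   place in the slice. *)
have [->|[x0 x0P]] := set_0Vmem (fiber (verts G :\: cover D) z C).
  by rewrite cards0 mul0r exprn_ge0 // ltW // nR_gt0.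
have /fiberP[x0C x0z] := x0P; set U := verts G :\: cover D in x0P x0z *.
have tD : (1 <= #|D| <= #|components G|)%N by rewrite lt0n D0 subset_leq_card.
have := smC _ D tD DG erefl; rewrite -rho3 -exprM /mu ler_pdivrMr ?exprn_gt0 ?nR_gt0 //.
rewrite mulrC ler_pdivlMr ?exprn_gt0 ?rho_gt0 //; apply: le_trans.
rewrite ler_pM2r ?exprn_gt0 ?rho_gt0 // ler_nat.
have x0U : restr U x0 \in assign n U.
  by apply: restr_assign (subsetP CG _ x0C) _; exact: subsetDl.
apply: leq_trans (leq_bigmax_cond (F := fun z => #|slice (cover D) C z|) _ x0U).
have CV x : x \in C -> x \in assign n (verts G) by exact: (subsetP CG).
rewrite -(card_in_imset (f := restr (cover D))) => [|x y].
  apply: subset_leq_card; apply/subsetP => _ /imsetP[x /fiberP[xC /agreesP xz] ->].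
  rewrite inE (restr_assign (CV x xC)) //=; suff -> : glue (restr (cover D) x) (restr U x0) = x by [].
  apply/ffunP => v; rewrite !ffunE; have [vD|vD] := boolP (v \in cover D).
    by have := assign_in (CV x xC) (subsetP DV v vD); case: (x v).
  have [vU|vU] := boolP (v \in U).
    have vV : v \in verts G by move: vU; rewrite inE => /andP[].
    rewrite (xz v vU (assign_in (CV x xC) vV)).
    by rewrite (agreesP _ _ _ x0z v vU (assign_in (CV x0 x0C) vV)).
  by rewrite (assign_notin (CV x xC)) //; move: vU; rewrite inE vD.
move=> /fiberP[xC /agreesP xz] /fiberP[yC /agreesP yz] /eqP/restr_eqP xy.
apply/ffunP => v; have [vV|vV] := boolP (v \in verts G); last first.
  by rewrite !(assign_notin (CV _ _) vV).
have [vD|vD] := boolP (v \in cover D); first exact: xy.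
have vU : v \in U by rewrite inE vD.
by rewrite (xz v vU (assign_in (CV x xC) vV)) (yz v vU (assign_in (CV y yC) vV)).
Qed.

(* The vertices outside the free components are counted trivially, and
   smallness is applied with all of them fixed. *)
Lemma small_fiber G C S z : small_pathset R G C ->
  #|fiber S z C|%:R * rho ^+ (3 * nfree G S) <= n%:R ^+ #|verts G :\: S| :> R.
Proof.
move=> sC; have CG := sC.1; set D := free_components G S.
have DG : D \subset components G by apply/subsetP => X /free_componentsP[].
have DV : cover D \subset verts G :\: S.
  apply/bigcupsP => X /free_componentsP[XG XS]; apply/subsetP => x xX.
  by rewrite inE (disjointFr XS xX) (subsetP (component_verts XG)).
set U := verts G :\: cover D.
have -> : #|verts G :\: S| = (#|U :\: S| + #|cover D|)%N.
  rewrite -(cardsID (cover D)) (setIidPr DV) addnC; congr (#|pred_of_set _| + _)%N.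
  by apply/setP => v; rewrite !inE; case: (v \in S); case: (v \in cover D).
have q0 : 0 < rho ^+ (3 * nfree G S) by rewrite exprn_gt0 ?rho_gt0.
rewrite exprD -ler_pdivlMr // -mulrA.
apply: le_trans (card_le_fibers (f := restr U) (M := n%:R ^+ #|cover D| / rho ^+ (3 * nfree G S)) _) _.
  move=> x /fiberP[xC xz]; rewrite ler_pdivlMr //.
  apply: le_trans (small_fiber_cover x sC DG); rewrite ler_pM2r // ler_nat.
  apply: subset_leq_card; apply/subsetP => y; rewrite inE => /andP[/fiberP[yC _] /restr_eqP yx].
  by apply/fiberP; split=> //; apply/agreesP => v /yx.
rewrite ler_wpM2r //; first by rewrite divr_ge0 ?exprn_ge0 // ltW // ?rho_gt0 ?nR_gt0.
by rewrite -natrX ler_nat; apply: card_restr_fiber CG _; exact: subsetDl.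
Qed.

(** [built T B c] says that [chi B <= c] when the coverings are restricted to
    those with the join pattern [T]. *)
Fixpoint built T B (c : R) : Prop :=
  match T with
  | Leaf i => B \subset assign n (verts [set i]) /\ #|B|%:R <= c
  | Node a b => exists (m : nat) (Ba Bb : 'I_m -> {set passign n k}) (ca cb : 'I_m -> R),
    [/\ forall i, small_pathset R (edges a) (Ba i) /\ built a (Ba i) (ca i),
        forall i, small_pathset R (edges b) (Bb i) /\ built b (Bb i) (cb i),
        B \subset \bigcup_i join (verts (edges a)) (verts (edges b)) (Ba i) (Bb i)
      & \sum_i (ca i + cb i) <= c]
  end.

Lemma built_pathset T B (c : R) : built T B c -> pathset (edges T) B.
Proof.
case: T => [i|a b] /=; first by move=> [].
move=> [m [Ba [Bb [ca [cb [_ _ Bj _]]]]]].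
apply: subset_trans Bj _; apply/bigcupsP => i _.
by rewrite vertsU; apply/subsetP => x; rewrite inE => /andP[].
Qed.

Lemma built_ge0 T B (c : R) : built T B c -> 0 <= c.
Proof.
elim: T B c => [i|a IHa b IHb] B c /=; first by move=> [_]; apply: le_trans.
move=> [m [Ba [Bb [ca [cb [ha hb _]]]]]]; apply: le_trans; apply: sumr_ge0 => i _.
by apply: addr_ge0; [apply: IHa (ha i).2 | apply: IHb (hb i).2].
Qed.

Lemma joinC V W B C : join V W B C = join W V C B :> {set passign n k}.
Proof. by apply/setP => x; rewrite !inE setUC [(_ \in B) && _]andbC. Qed.

Lemma built_swap a b B (c : R) : built (Node a b) B c -> built (Node b a) B c.
Proof.
move=> [m [Ba [Bb [ca [cb [ha hb Bj Bc]]]]]]; exists m, Bb, Ba, cb, ca; split=> //.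
  by apply: subset_trans Bj _; apply/bigcupsP => i _; rewrite joinC (bigcup_sup i).
by under eq_bigr do rewrite addrC.
Qed.

Lemma built0 T (c : R) : 0 <= c -> built T set0 c.
Proof.
move=> c0; case: T => [i|a b] /=; first by rewrite sub0set cards0.
by exists 0%N, (fun=> set0), (fun=> set0), (fun=> 0), (fun=> 0); split=> [[]//|[]//||];
  rewrite ?sub0set // big_ord0.
Qed.

(** [bound T S w]: with the coordinates in [S] fixed, a pathset built along [T]
    at cost [c] has density at most [c / w]. *)
Definition bound T S w := forall B c z, built T B c ->
  #|fiber S z B|%:R * w <= c * n%:R ^+ #|verts (edges T) :\: S|.

Definition small_bound T S w := forall B c z, built T B c ->
  small_pathset R (edges T) B ->
  #|fiber S z B|%:R * w <= c * n%:R ^+ #|verts (edges T) :\: S|.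

Lemma bound_small T S w : bound T S w -> small_bound T S w.
Proof. by move=> h B c z Bc _; exact: h. Qed.

Lemma bound_le T S w w' : w' <= w -> bound T S w -> bound T S w'.
Proof. by move=> ww h B c z /(h B c z); apply: le_trans; exact: ler_wpM2l. Qed.

Lemma small_bound_le T S w w' : w' <= w -> small_bound T S w -> small_bound T S w'.
Proof. by move=> ww h B c z Bc sB; apply: le_trans (h B c z Bc sB); exact: ler_wpM2l. Qed.

Lemma bound_swap a b S w : bound (Node a b) S w -> bound (Node b a) S w.
Proof. by move=> h B c z /built_swap/h; rewrite /= setUC; apply. Qed.

Lemma bound_leaf (i : 'I_k) S : bound (Leaf i) S (n%:R ^+ #|verts [set i] :\: S|).
Proof.
move=> B c z /= [_ Bc]; rewrite ler_pM2r ?exprn_gt0 ?nR_gt0 //.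
apply: le_trans Bc; rewrite ler_nat; apply: subset_leq_card.
by apply/subsetP => x /fiberP[].
Qed.

Lemma card_bigcup_le (I : finType) (U : finType) (F : I -> {set U}) (A : {set U}) :
  A \subset \bigcup_i F i -> #|A|%:R <= \sum_i #|F i|%:R :> R.
Proof.
move=> AF; rewrite -natr_sum ler_nat; apply: leq_trans (subset_leq_card AF) _.
elim/big_rec2: _ => [|i m X _ h]; first by rewrite cards0.
by apply: leq_trans (leq_card_setU _ _) _; rewrite leq_add2l.
Qed.

(** By a union bound over the covering it is enough to treat one join. Its size is charged to the
    cost of the first factor alone, the other cost being nonnegative. *)
Lemma bound_node a b S w : 0 < w ->
  (forall Ba Bb c z, small_pathset R (edges a) Ba -> small_pathset R (edges b) Bb ->
    built a Ba c ->
    #|fiber S z (join (verts (edges a)) (verts (edges b)) Ba Bb)|%:R * w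
      <= c * n%:R ^+ #|verts (edges a :|: edges b) :\: S|) ->
  bound (Node a b) S w.
Proof.
move=> w0 h B c z [m [Ba [Bb [ca [cb [ha hb Bj Bc]]]]]].
rewrite -ler_pdivlMr //.
have zj : fiber S z B \subset
    \bigcup_i fiber S z (join (verts (edges a)) (verts (edges b)) (Ba i) (Bb i)).
  apply/subsetP => x /fiberP[/(subsetP Bj)/bigcupP[i _ xi] xz].
  by apply/bigcupP; exists i => //; apply/fiberP.
apply: le_trans (card_bigcup_le zj) _; rewrite ler_pdivlMr // mulr_suml /=.
apply: le_trans (ler_sum _ (fun i _ => h _ _ (ca i) z (ha i).1 (hb i).1 (ha i).2)) _.
rewrite -mulr_suml; apply: ler_wpM2r; first by rewrite exprn_ge0 // ltW // nR_gt0.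
apply: le_trans Bc; apply: ler_sum => i _; rewrite lerDl.
exact: built_ge0 (hb i).2.
Qed.

Lemma card_vertsU_D G H S :
  #|verts (G :|: H) :\: S| = (#|verts G :\: S| + #|verts H :\: (S :|: verts G)|)%N.
Proof.
rewrite vertsU -(cardsID (verts G) ((verts G :|: verts H) :\: S)).
congr (_ + _)%N; apply: eq_card => v; rewrite !inE.
  by case: (v \in S); case: [exists i in G, _] => //=; rewrite ?andbF ?andbT.
by case: (v \in S); case: [exists i in G, _] => //=; rewrite ?andbF ?andbT.
Qed.

(* Smallness of the second factor, given the first. *)
Lemma bound_extend a b S w : 0 < w -> small_bound a S w ->
  bound (Node a b) S (w * rho ^+ (3 * nfree (edges b) (S :|: verts (edges a)))).
Proof.
move=> w0 ha; set q := rho ^+ _; have q0 : 0 < q by rewrite exprn_gt0 ?rho_gt0.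
apply: bound_node => [|Ba Bb c z sa sb bc]; first exact: mulr_gt0.
rewrite -ler_pdivlMr ?mulr_gt0 //.
set V := verts (edges a) :\: S; set W := verts (edges b) :\: (S :|: verts (edges a)).
apply: le_trans (card_join_fiber _ (M1 := c * n%:R ^+ #|V| / w) (M2 := n%:R ^+ #|W| / q) _ _) _.
- by rewrite ler_pdivlMr //; exact: ha.
- by move=> z'; rewrite ler_pdivlMr //; exact: small_fiber.
- by rewrite card_vertsU_D exprD invfM le_eqVlt; apply/orP; left; apply/eqP; ring.
Qed.

(* Smallness of the second factor first, then the first factor given the second. *)
Lemma bound_absorb a b S w : 0 < w -> small_bound a (S :|: verts (edges b)) w ->
  bound (Node a b) S (w * rho ^+ (3 * nfree (edges b) S)).
Proof.
move=> w0 ha; set q := rho ^+ _; have q0 : 0 < q by rewrite exprn_gt0 ?rho_gt0.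
apply: bound_node => [|Ba Bb c z sa sb bc]; first exact: mulr_gt0.
rewrite -ler_pdivlMr ?mulr_gt0 // joinC.
set V := verts (edges a) :\: (S :|: verts (edges b)); set W := verts (edges b) :\: S.
apply: le_trans (card_join_fiber _ (M1 := n%:R ^+ #|W| / q) (M2 := c * n%:R ^+ #|V| / w) _ _) _.
- by rewrite ler_pdivlMr //; exact: small_fiber.
- by move=> z'; rewrite ler_pdivlMr //; exact: ha.
- by rewrite setUC card_vertsU_D exprD invfM le_eqVlt; apply/orP; left; apply/eqP; ring.
Qed.

(** The projection of a join to [verts (edges t)] is contained in that of the factor whose tree
    contains [t], and the costs of these factors add up to at most [c]. *)
Lemma bound_proj t T S w B (c : R) z : 0 < w -> subtree t T -> small_bound t S w ->
  built T B c -> small_pathset R (edges T) B ->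
  #|restr (verts (edges t)) @: fiber S z B|%:R * w
    <= c * n%:R ^+ #|verts (edges t) :\: S|.
Proof.
move=> w0 tT ht; elim: T B c tT => [i|a IHa b IHb] B c tT Bc sB.
  case: tT => // tE; rewrite tE in ht *; apply: le_trans (ht B c z Bc sB).
  by rewrite ler_pM2r // ler_nat leq_imset_card.
case: tT => [tE|tab].
  rewrite tE in ht *; apply: le_trans (ht B c z Bc sB).
  by rewrite ler_pM2r // ler_nat leq_imset_card.
wlog ta : a b IHa IHb Bc sB tab / subtree t a.
  move=> hw; case: (tab) => h; first exact: (hw a b).
  by apply: (hw b a IHb IHa (built_swap Bc) _ _ h); [rewrite /= setUC|left].
move: Bc => [m [Ba [Bb [ca [cb [ha hb Bj Bc]]]]]].
pose V := verts (edges t).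
have zj : restr V @: fiber S z B \subset \bigcup_i restr V @: fiber S z (Ba i).
  apply/subsetP => _ /imsetP[x /fiberP[/(subsetP Bj)/bigcupP[i _ xi] xz] ->].
  apply/bigcupP; exists i => //; apply/imsetP; exists (restr (verts (edges a)) x).
    by apply/fiberP; split; [move: xi; rewrite inE => /and3P[]|exact: agrees_restr].
  by rewrite restr_restr // verts_sub // subtree_edges.
rewrite -ler_pdivlMr //; apply: le_trans (card_bigcup_le zj) _.
rewrite ler_pdivlMr // mulr_suml.
apply: le_trans (ler_sum _ (fun i _ => IHa _ (ca i) ta (ha i).2 (ha i).1)) _.
rewrite -mulr_suml; apply: ler_wpM2r; first by rewrite exprn_ge0 // ltW // nR_gt0.
apply: le_trans Bc; apply: ler_sum => i _; rewrite lerDl.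
exact: built_ge0 (hb i).2.
Qed.

(* The set [B] is split according to whether the fiber over the projection to
   the vertices of [t] has density at most [rho ^- p].  The dense fibers sit over
   a set of density at most [rho ^+ p * rho ^- (3 * nfree)]. *)
Lemma small_bound_split t T S w1 w2 p : 0 < w1 -> 0 < w2 -> subtree t T ->
  small_bound t S w1 -> small_bound T (S :|: verts (edges t)) w2 ->
  small_bound T S ((w1^-1 * rho ^- p + w2^-1 * rho ^+ p * rho ^- (3 * nfree (edges T) S))^-1).
Proof.
move=> w10 w20 tT h1 h2 B c z Bc sB; set q := rho ^+ (3 * _).
have [rp q0] : 0 < rho ^+ p /\ 0 < q by rewrite !exprn_gt0 ?rho_gt0.
have c0 := built_ge0 Bc.
pose V := verts (edges t); pose VT := verts (edges T).
have VVT : V \subset VT by rewrite verts_sub // subtree_edges.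
have n0 m : 0 < n%:R ^+ m :> R by rewrite exprn_gt0 ?nR_gt0.
have cardV : #|VT :\: S| = (#|V :\: S| + #|VT :\: (S :|: V)|)%N.
  have := card_vertsU_D (edges t) (edges T) S.
  by rewrite (setUidPr (subtree_edges tT)).
rewrite -ler_pdivlMr ?invr_gt0 ?addr_gt0 ?mulr_gt0 ?invr_gt0 // invrK.
pose F := fiber S z B.
pose Fx x := [set y in F | restr V y == restr V x].
pose th : R := n%:R ^+ #|VT :\: (S :|: V)| / rho ^+ p.
have th0 : 0 < th by rewrite divr_gt0.
pose F1 := [set x in F | #|Fx x|%:R <= th]; pose F2 := F :\: F1.
have -> : #|F| = (#|F1| + #|F2|)%N.
  rewrite -(cardsID F1); congr (#|pred_of_set _| + _)%N.
  by apply/setIidPr/subsetP => x; rewrite inE => /andP[].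
rewrite natrD mulrDr; apply: lerD.
  apply: le_trans (card_le_fibers (f := restr V) (M := th) _) _.
    move=> x; rewrite inE => /andP[_]; apply: le_trans; rewrite ler_nat.
    by apply: subset_leq_card; apply/subsetP => y; rewrite !inE => /andP[/andP[-> _] ->].
  apply: (@le_trans _ _ (#|restr V @: F|%:R * th)).
    rewrite ler_pM2r // ler_nat; apply: subset_leq_card; apply: imsetS.
    by apply/subsetP => x; rewrite inE => /andP[].
  have := bound_proj z w10 tT h1 Bc sB; rewrite -ler_pdivlMr // => hp.
  apply: (le_trans (ler_wpM2r (ltW th0) hp)).
  by rewrite cardV exprD /th le_eqVlt; apply/orP; left; apply/eqP; rewrite /V; ring.
have F2x x : x \in F2 -> th < #|Fx x|%:R.
  by rewrite !inE ltNge => /andP[]; case: (x \in B) => //=; case: agrees => //=; rewrite andbF.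
pose P2 := restr V @: F2.
(* The fibers over distinct points of [P2] are disjoint and larger than [th], while smallness bounds
   [F] as a whole. *)
have P2c : #|P2|%:R * th <= n%:R ^+ #|VT :\: S| / q.
  apply: (@le_trans _ _ #|F|%:R); last by rewrite ler_pdivlMr //; exact: small_fiber.
  rewrite -[#|F|]sum1_card natr_sum (partition_big_imset (restr V)) /=.
  have P2F : P2 \subset restr V @: F by apply: imsetS; exact: subsetDl.
  rewrite (big_setID P2) /= (setIidPr P2F) -[leLHS]addr0; apply: lerD; last first.
    by apply: sumr_ge0 => y _; apply: sumr_ge0.
  rewrite mulr_natl -sumr_const; apply: ler_sum => _ /imsetP[x xF2 ->].
  rewrite -natr_sum sum1_card; apply: le_trans (ltW (F2x x xF2)) _.
  rewrite ler_nat; apply: subset_leq_card; apply/subsetP => y.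
  by rewrite [in X in X -> _]inE.
apply: le_trans (card_le_fibers (f := restr V) (M := c * n%:R ^+ #|VT :\: (S :|: V)| / w2) _) _.
  move=> x; rewrite in_setD => /andP[_ /fiberP[xB xz]].
  rewrite ler_pdivlMr //; apply: le_trans (h2 B c x Bc sB).
  rewrite ler_pM2r // ler_nat; apply: subset_leq_card; apply/subsetP => y.
  rewrite in_set => /andP[]; rewrite in_setD => /andP[_ /fiberP[yB yz]] /restr_eqP yx.
  apply/fiberP; split=> //; apply/agreesP => v; rewrite inE => /orP[vS|/yx //] yv.
  have BV := subsetP (built_pathset Bc); have xv : x v.
    by rewrite (assignP _ _ (BV x xB)) -(assignP _ _ (BV y yB)).
  by rewrite (agreesP _ _ _ yz v vS yv) (agreesP _ _ _ xz v vS xv).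
have := P2c; rewrite -ler_pdivlMr // => P2c'.
apply: (le_trans (ler_wpM2r _ P2c')).
  by rewrite !mulr_ge0 // ?invr_ge0 ltW.
rewrite cardV exprD /th invf_div le_eqVlt; apply/orP; left; apply/eqP.
by rewrite /V; field; rewrite !lt0r_neq0.
Qed.

(** * Potentials and the two claims *)

Section Recursion.
Implicit Types (c d : jtree k) (X Z O : {set 'I_k.+1}).
Implicit Types (K : {set 'I_k}) (u v x y z : 'I_k.+1) (r p : nat).

(** The potential [p] is counted in thirds; [2 ^ r] makes up for the two costs that each [free_step]
    adds. *)
Definition weight r p : R := rho ^+ p / 2 ^+ r.

Lemma weight_gt0 r p : 0 < weight r p.
Proof. by rewrite divr_gt0 ?exprn_gt0 // rho_gt0. Qed.

Lemma weight_le r r' p p' : (r' <= r)%N -> (p <= p')%N -> weight r p <= weight r' p'.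
Proof.
move=> rr pp; rewrite /weight; apply: ler_pM.
- by rewrite exprn_ge0 // ltW // rho_gt0.
- by rewrite invr_ge0 exprn_ge0.
- by apply: ler_weXn2l => //; exact: rho_ge1.
- by rewrite lef_pV2 ?posrE ?exprn_gt0 //; apply: ler_weXn2l; rewrite ?ler1n.
Qed.

Lemma weightM r p q : weight r p * rho ^+ q = weight r (p + q).
Proof. by rewrite /weight mulrAC -exprD. Qed.

(** Components of [T] missing [S] and [c] are components of [d]; by smallness of the factor at [d],
    each is worth [rho ^+ 3]. *)
Lemma children_extend c d T S r p q : children c d T ->
  small_bound c S (weight r p) ->
  (q <= p + 3 * nfree (edges T) (S :|: verts (edges c)))%N ->
  bound T S (weight r q).
Proof.
move=> cdT hc hq; have {hc} := bound_extend (b := d) (weight_gt0 _ _) hc.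
rewrite weightM => h.
have {h} h : bound T S (weight r (p + 3 * nfree (edges d) (S :|: verts (edges c)))).
  by case: cdT => -> //; exact: bound_swap.
apply: bound_le h; apply: weight_le => //; apply: leq_trans hq _.
by rewrite leq_add2l leq_mul2l /= (children_edges cdT) nfree_setU.
Qed.

Lemma children_absorb c d T S r p q : children c d T ->
  small_bound d (S :|: verts (edges c)) (weight r p) ->
  (q <= p + 3 * nfree (edges c) S)%N ->
  bound T S (weight r q).
Proof.
move=> cdT hc hq; have {hc} := bound_absorb (weight_gt0 _ _) hc.
rewrite weightM => h.
have {h} h : bound T S (weight r (p + 3 * nfree (edges c) S)).
  by case: cdT => -> //; exact: bound_swap.
by apply: bound_le h; apply: weight_le.
Qed.

(** The descent follows [y] to a leaf, where the coordinate [y] is free and gives a factor [n], at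
    least [rho ^+ 3]. On the way, [nfree_sub0] keeps account of the free components. *)
Lemma bound_vertex T S y : y \in verts (edges T) -> y \notin S ->
  bound T S (weight 0 (3 + 3 * nfree (edges T) (S :|: [set y]))).
Proof.
elim: T S y => [i|a IHa b IHb] S y yT yS.
  apply: (bound_le _ (@bound_leaf i S)) => /=.
  have -> : nfree [set i] (S :|: [set y]) = 0%N.
    apply/eqP; rewrite cards_eq0; apply/eqP/setP => X; rewrite in_set0; apply/negP.
    move=> /free_componentsP[XG]; have [x xX] := component_neq0 XG.
    rewrite disjoint_setUr disjoint_sym [in X in _ && X]disjoint_sym disjoints1 => /andP[_ /negP]; apply.
    by rewrite (componentE XG xX) inE leaf_linked // (subsetP (component_verts XG)).
  rewrite /weight expr0 divr1 muln0 addn0; apply: le_trans (rho3_le) _.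
  rewrite -[leLHS]expr1; apply: ler_weXn2l; first by rewrite ler1n.
  by rewrite card_gt0; apply/set0Pn; exists y; rewrite inE yS.
wlog ya : a b IHa IHb yT / y \in verts (edges a).
  move=> hw; move: (yT); rewrite /= vertsU => /setUP[] h; first exact: (hw a b).
  have := hw b a IHb IHa; rewrite /= [edges b :|: _]setUC => {}hw.
  by apply: bound_swap; exact: hw.
apply: (@children_extend a b _ _ _ _ _ (or_introl erefl) (bound_small (IHa S y ya yS))).
have ab : edges a \subset edges (Node a b) by exact: subsetUl.
have := nfree_sub0 (S :|: [set y]) ab.
rewrite -setUA (setUidPr (_ : [set y] \subset verts (edges a))) ?sub1set //.
lia.
Qed.

Definition free_claim r := forall T S X, X \in components (edges T) ->
  [disjoint X & S] -> (4 ^ r <= #|X|)%N ->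
  small_bound T S (weight r (r + 3 * nfree (edges T) S)).

Definition segment_claim r := forall T S Y, segment (edges T) Y ->
  [disjoint Y & S] -> (4 ^ r <= #|Y|)%N ->
  bound T S (weight r (r + 2 + 3 * nfree (edges T) (S :|: Y))).

Lemma segment_claim0 : segment_claim 0.
Proof.
move=> T S Y sY YS; rewrite expn0 => /card_gt0P[y yY].
have yS : y \notin S by rewrite (disjointFr YS yY).
apply: (bound_le _ (bound_vertex (subsetP (segment_verts sY) y yY) yS)).
apply: weight_le => //; rewrite add0n leq_add // leq_mul2l /=.
by apply: nfree_anti; apply: setUS; rewrite sub1set.
Qed.

Lemma free_claim0 : free_claim 0.
Proof.
move=> T S X XT XS _; have [y yX] := component_neq0 XT.
have yS : y \notin S by rewrite (disjointFr XS yX).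
apply: bound_small.
apply: (bound_le _ (bound_vertex (subsetP (component_verts XT) y yX) yS)).
by apply: weight_le => //; have := nfree1 (edges T) S y; lia.
Qed.

(** * Induction step for subpaths *)

Section Split.
Variable r : nat.
Hypothesis free_r : forall r', (r' <= r)%N -> free_claim r'.
Hypothesis segment_r : forall r', (r' <= r)%N -> segment_claim r'.

(* One of the following pieces of [Y] is long: a component of [c] inside [Y],
   the vertices of [Y] joined in [c] to the outside of [Y] on one side, or one
   of the gaps that [c] leaves in [Y].  The [s] components of [c] inside [Y] pay
   for the loss of length. *)
Lemma bound_inner c d T S Y : children c d T -> segment (edges T) Y ->
  [disjoint Y & S] -> (2 * 4 ^ r <= #|Y|)%N ->
  (0 < #|inner_components (edges c) Y|)%N ->
  bound T S (weight r (r + 3 + 3 * nfree (edges T) (S :|: Y))).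
Proof.
move=> cdT sY YS Yr; set P := inner_components _ _ => s0.
have cT := children_sub cdT; have sP := leq_expn4 s0.
have key := nfree_sub_inner cT YS; rewrite -/P in key.
set V := verts (edges c) in key *; set s := #|P| in s0 sP key *.
(* Through [key] the inner components are worth [3 * s]. The remaining [r + 3 - 3 * s] must come
   from the long piece; a segment brings 2 more than its exponent, so [r + 1 - 3 * s] suffices for
   it. *)
have rs : (r + 3 - 3 * s <= r)%N by lia.
have rs' : (r + 1 - 3 * s <= r)%N by lia.
have [/existsP[Z /andP[ZP Zr]]|] := boolP [exists Z in P, 4 ^ (r + 3 - 3 * s) <= #|Z|]%N.
  have /inner_componentsP[Zc ZY] := ZP.
  have h := free_r rs Zc (disjointWl ZY YS) Zr.
  apply: (bound_le _ (children_extend cdT h (leqnn _))).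
  apply: weight_le => //.
  have : (nfree (edges T) (S :|: V :|: Y) <= nfree (edges T) (S :|: V))%N.
    by apply: nfree_anti; exact: subsetUl.
  move: key; rewrite -/V; clear; lia.
rewrite negb_exists_in => /forall_inP hP.
pose e := (r + 1 - 3 * s)%N.
have cY := sY.1.
have hA O : [disjoint O & Y] -> one_sided Y O -> (4 ^ e <= #|attached (edges c) Y O|)%N ->
    bound T S (weight r (r + 3 + 3 * nfree (edges T) (S :|: Y))).
  move=> OY sO hO; set A := attached _ _ _ in hO.
  have AY : A \subset Y by apply/subsetP => y /attachedP[].
  have A0 : exists y, y \in A by apply/card_gt0P; apply: leq_trans hO; rewrite expn_gt0.
  have h := segment_r rs' (attached_segment cY sO A0) (disjointWl AY YS) hO.
  apply: (bound_le _ (children_extend cdT (bound_small h) (leqnn _))).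
  apply: weight_le => //; rewrite -/A -/V.
  have h1 := nfree_sub (S :|: A) Y cT.
  have E1 : S :|: A :|: Y = S :|: Y by rewrite -setUA (setUidPr AY).
  (* The inner components avoid [A], so all [s] of them remain free. *)
  have E2 : (s <= #|[set Z in inner_components (edges c) Y | [disjoint Z & S :|: A]]|)%N.
    apply: subset_leq_card; apply/subsetP => Z ZP.
    rewrite in_set ZP disjoint_setUr (attached_inner OY) // andbT.
    by have /inner_componentsP[_ ZY] := ZP; exact: disjointWl YS.
  have E3 : (nfree (edges T) (S :|: A :|: V :|: Y) <= nfree (edges T) (S :|: V))%N.
    apply: nfree_anti; apply: subset_trans (subsetUl _ Y).
    by apply: setSU; exact: subsetUl.
  rewrite E1 -/V in h1; move: h1 E2 E3; rewrite /e; clear; lia.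
have [/hA|hL] := leqP (4 ^ e) #|attached (edges c) Y (left_of Y)|.
  by apply; [exact: left_disjoint|exact: left_sided].
have [/hA|hR] := leqP (4 ^ e) #|attached (edges c) Y (right_of Y)|.
  by apply; [exact: right_disjoint|exact: right_sided].
have hG j : (4 ^ e <= #|gap (edges c) Y j|)%N ->
    bound T S (weight r (r + 3 + 3 * nfree (edges T) (S :|: Y))).
  move=> hj; set A := gap _ _ _ in hj.
  have AY : A \subset Y by apply/subsetP => y /gapP[].
  have AV y : y \in A -> y \notin V by move=> /gapP[].
  have [x xA] : exists y, y \in A by apply/card_gt0P; apply: leq_trans hj; rewrite expn_gt0.
  have cA : convex A by move=> u v w uA wA; exact: (gap_between cY uA wA).
  have xd : x \in verts (edges d).
    have := subsetP (segment_verts sY) x (subsetP AY x xA).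
    by rewrite (children_verts cdT) => /setUP[] //; rewrite (negbTE (AV x xA)).
  (* No vertex of the gap is in [V], so the edges of [T] inside it come from [d]. *)
  have sA : segment (edges d) A.
    apply: (segmentI cA xd) => y yA; apply/linkedP => i ixy.
    have : i \in edges T.
      by apply: (linkedP _ _ _ (segment_linked sY (subsetP AY x xA) (subsetP AY y yA))).
    rewrite (children_edges cdT) => /setUP[] // ic.
    have ik : (i < k.+1)%N by rewrite ltnW // ltnS.
    suff : Ordinal ik \in A.
      by move/AV/negP; case; apply/vertsP; exists i => //=; rewrite eqxx.
    move: ixy; case: (leqP x y) => xy /= ixy.
      by apply: (cA x _ y) => //=; lia.
    by apply: (cA y _ x) => //=; lia.
  have AS : [disjoint A & S :|: V].
    rewrite disjoint_setUr (disjointWl AY YS) /=.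
    by apply/negPn/negP => /meetP[y /AV/negP].
  have h := segment_r rs' sA AS hj.
  apply: (bound_le _ (children_absorb cdT (bound_small h) (leqnn _))).
  apply: weight_le => //.
  have h1 : (nfree (edges T) (S :|: V :|: Y) <= nfree (edges d) (S :|: V :|: A))%N.
    apply: (@leq_trans (nfree (edges T) (S :|: A :|: V))).
      by apply: nfree_anti; rewrite setUAC setUS.
    by rewrite (children_edges cdT) [S :|: V :|: A]setUAC; exact: nfree_setU.
  move: key h1; rewrite /e -/V; clear; lia.
have [/existsP[j /hG //]|] := boolP [exists j : 'I_s.+1, 4 ^ e <= #|gap (edges c) Y j|]%N.
rewrite negb_exists => /forallP hgap.
suff : (#|Y| < 2 * 4 ^ r)%N by rewrite ltnNge Yr.
apply: leq_ltn_trans (split_arith r s0).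
pose AL := attached (edges c) Y (left_of Y); pose AR := attached (edges c) Y (right_of Y).
(* A component of [c] that meets [Y] without lying inside it leaves it on the left or on the right,
   so every vertex of [Y] is in one of the pieces. *)
have YU : Y \subset cover P :|: (AL :|: (AR :|: (Y :\: V))).
  apply/subsetP => y yY; rewrite !in_setU in_setD yY andbT.
  have [yV|//] := boolP (y \in V); last by rewrite !orbT.
  have yc := component_components yV.
  have [cyY|/subsetPn[w wc wY]] := boolP (component (edges c) y \subset Y).
    apply/orP; left; apply/bigcupP; exists (component (edges c) y); last exact: mem_component.
    exact/inner_componentsP.
  have lyw : linked (edges c) y w by move: wc; rewrite inE.
  case: (convex_notin cY wY yY) => h; apply/orP; right; apply/orP; [left|right; apply/orP; left].
    by apply/attachedP; split=> //; exists w => //; exact/left_ofP.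
  by apply/attachedP; split=> //; exists w => //; exact/right_ofP.
apply: leq_trans (subset_leq_card YU) _.
apply: leq_trans (leq_card_setU _ _) _.
have -> : (s + 3 = 1 + (1 + s.+1))%N by clear; lia.
rewrite !mulnDl !mul1n; apply: leq_add.
  apply: leq_trans (leq_card_cover _) _; rewrite -/P.
  rewrite -[X in (_ <= X)%N]sum_nat_const; apply: leq_sum => Z ZP.
  have p0 : (0 < 4 ^ (r + 3 - 3 * s))%N by rewrite expn_gt0.
  by have := hP Z ZP; rewrite -ltnNge; move: p0; clear; lia.
have e0 : (0 < 4 ^ e)%N by rewrite expn_gt0.
apply: leq_trans (leq_card_setU _ _) _; apply: leq_add.
  by rewrite -ltnS (prednK e0); exact: hL.
apply: leq_trans (leq_card_setU _ _) _; apply: leq_add.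
  by rewrite -ltnS (prednK e0); exact: hR.
have YG : Y :\: V \subset \bigcup_(j : 'I_s.+1) gap (edges c) Y j.
  apply/subsetP => y /setDP[yY yV].
  have js : (#|inner_left (edges c) Y y| < s.+1)%N.
    by rewrite ltnS; apply: subset_leq_card; apply/subsetP => Z /inner_leftP[].
  by apply/bigcupP; exists (Ordinal js) => //; apply/gapP.
apply: leq_trans (subset_leq_card YG) _.
apply: (@leq_trans (\sum_(j < s.+1) (4 ^ e).-1)); last by rewrite sum_nat_const card_ord.
apply: (@leq_trans (\sum_(j < s.+1) #|gap (edges c) Y j|)).
  elim/big_rec2: _ => [|i m X _ h]; first by rewrite cards0.
  by apply: leq_trans (leq_card_setU _ _) _; rewrite leq_add2l.
by apply: leq_sum => j _; rewrite -ltnS (prednK e0) ltnNge; exact: hgap.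
Qed.

(** A free component of [T] either is accounted for in [c] or misses [verts (edges c)], so nothing
    is lost between child and parent. *)
Lemma descend c d T S Y Y' r' p : children c d T -> Y' \subset Y ->
  bound c S (weight r' (p + 3 * nfree (edges c) (S :|: Y'))) ->
  bound T S (weight r' (p + 3 * nfree (edges T) (S :|: Y))).
Proof.
move=> cdT YY h; apply: (children_extend cdT (bound_small h)).
rewrite -addnA leq_add2l -mulnDr leq_mul2l /=.
apply: leq_trans (nfree_anti _ (setUS S YY)) _.
apply: leq_trans (nfree_sub0 _ (children_sub cdT)) _; rewrite leq_add2l.
by apply: nfree_anti; rewrite setUAC; exact: subsetUl.
Qed.

Lemma segment_leaf (i : 'I_k) Y : segment (edges (Leaf i)) Y -> (#|Y| <= 2)%N.
Proof.
by move=> /segment_verts/subset_leq_card; rewrite /= verts1_card.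
Qed.

(** The descent follows the pinned vertex: its component in the child either contains [Y], which
    stays pinned there, or lies inside [Y], where [bound_inner] applies. *)
Lemma bound_pinned T S Y : pinned_segment (edges T) Y -> [disjoint Y & S] ->
  (2 * 4 ^ r <= #|Y|)%N ->
  bound T S (weight r (r + 3 + 3 * nfree (edges T) (S :|: Y))).
Proof.
elim: T => [i|a IHa b IHb] sY YS Yr.
  (* A leaf has two vertices, which forces [r = 0]; the 3 of [bound_vertex] is then the required
     [r + 3]. *)
  have r0 : r = 0%N.
    have := leq_trans Yr (segment_leaf sY.1); case: (r) => // m; rewrite expnS.
    have : (0 < 4 ^ m)%N by rewrite expn_gt0.
    by clear; lia.
  have [y yY] : exists y, y \in Y by apply/card_gt0P; apply: leq_trans Yr; rewrite r0.
  have yS : y \notin S by rewrite (disjointFr YS yY).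
  have yT := subsetP (segment_verts sY.1) y yY.
  apply: (bound_le _ (bound_vertex yT yS)); rewrite r0.
  apply: weight_le => //; rewrite add0n leq_add2l leq_mul2l /=.
  by apply: nfree_anti; apply: setUS; rewrite sub1set.
have step c d : children c d (Node a b) ->
    (pinned_segment (edges c) Y -> [disjoint Y & S] -> (2 * 4 ^ r <= #|Y|)%N ->
      bound c S (weight r (r + 3 + 3 * nfree (edges c) (S :|: Y)))) ->
    forall y, y \in Y -> pinned (edges (Node a b)) Y y -> y \in verts (edges c) ->
    bound (Node a b) S (weight r (r + 3 + 3 * nfree (edges (Node a b)) (S :|: Y))).
  move=> cdT IH y yY py yc; have ccomp := component_components yc.
  have [cY|Yc] := py _ (children_sub cdT) yc.
    apply: (bound_inner cdT sY.1 YS Yr); apply/card_gt0P; exists (component (edges c) y).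
    exact/inner_componentsP.
  apply: (descend cdT (subxx Y)); apply: IH => //; split.
    by split; [exact: sY.1.1|exists (component (edges c) y)].
  exists y => // H' H'c; apply: py; exact: subset_trans (children_sub cdT).
have [sY1 [y yY py]] := sY.
have := subsetP (segment_verts sY1) y yY; rewrite /= vertsU => /setUP[] yc.
  exact: (step a b (or_introl erefl) IHa y).
exact: (step b a (or_intror erefl) IHb y).
Qed.

Lemma segment_step : segment_claim r.+1.
Proof.
(* The exponents [r + 3] and [r.+1 + 2] agree, and no factor 2 is lost in this step. *)
suff h T S Y : segment (edges T) Y -> [disjoint Y & S] -> (4 ^ r.+1 <= #|Y|)%N ->
    bound T S (weight r (r + 3 + 3 * nfree (edges T) (S :|: Y))).
  move=> T S Y sY YS Yr; apply: (bound_le _ (h T S Y sY YS Yr)).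
  by apply: weight_le => //; rewrite leq_add2r; clear; lia.
elim: T => [i|a IHa b IHb] sY YS Yr.
  have := leq_trans Yr (segment_leaf sY); rewrite expnS.
  have : (0 < 4 ^ r)%N by rewrite expn_gt0.
  by clear; lia.
have p0 : (0 < 4 ^ r)%N by rewrite expn_gt0.
have Yr2 : (2 * 4 ^ r <= #|Y|)%N by move: Yr; rewrite expnS; clear; lia.
have stepin c d : children c d (Node a b) ->
    (segment (edges c) Y -> [disjoint Y & S] -> (4 ^ r.+1 <= #|Y|)%N ->
      bound c S (weight r (r + 3 + 3 * nfree (edges c) (S :|: Y)))) ->
    bound (Node a b) S (weight r (r + 3 + 3 * nfree (edges (Node a b)) (S :|: Y))) \/
    inner_components (edges c) Y = set0 /\
    exists i, [/\ i \notin edges c, src i \in Y & tgt i \in Y].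
  move=> cdT IH; have [iY0|] := eqVneq #|inner_components (edges c) Y| 0%N; last first.
    by rewrite -lt0n => i0; left; exact: (bound_inner cdT).
  have [/existsP[X /andP[Xc YX]]|] := boolP [exists X in components (edges c), Y \subset X].
    left; apply: (descend cdT (subxx Y)); apply: IH => //.
    by split; [exact: sY.1|exists X].
  rewrite negb_exists_in => /forall_inP hX; right; split; first exact: cards0_eq.
  by apply: missing_edge => //; [exact: sY.1|move: Yr2 p0; clear; lia].
have stepout c d e f : children c d (Node a b) ->
    inner_components (edges c) Y = set0 -> inner_components (edges d) Y = set0 ->
    src e \in Y -> tgt f \in Y -> (e < f)%N -> e \notin edges c -> f \notin edges d ->
    bound (Node a b) S (weight r (r + 3 + 3 * nfree (edges (Node a b)) (S :|: Y))).
  move=> cdT ic id eY fY ef ec fd.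
  have sY' : segment (edges c :|: edges d) Y by rewrite -(children_edges cdT).
  have [Y1 [Y2 [pY1 pY2 Y1Y Y2Y Y12]]] := overlap_split sY' ic id eY fY ef ec fd.
  (* The two pieces cover [Y], so one of them has [2 * 4 ^ r] vertices. *)
  have [Y1r|Y1r] := leqP (2 * 4 ^ r) #|Y1|.
    apply: (descend (children_sym cdT) Y1Y); apply: bound_pinned => //.
    exact: disjointWl YS.
  apply: (descend cdT Y2Y); apply: bound_pinned => //; first exact: disjointWl YS.
  by move: Yr Y1r Y12; rewrite expnS; clear; lia.
have [//|[ia [e [ea eY eY']]]] := stepin a b (or_introl erefl) IHa.
have [//|[ib [f [fb fY fY']]]] := stepin b a (or_intror erefl) IHb.
have [ef|fe|/val_inj E] := ltngtP e f.
- exact: (stepout a b e f (or_introl erefl)).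
- exact: (stepout b a f e (or_intror erefl)).
(* An edge inside [Y] missing from both children would be missing from the whole tree. *)
have := segment_linked sY eY eY' => /linkedP/(_ e); rewrite src_val tgt_val /=.
rewrite in_setU (negbTE ea) E (negbTE fb) => h.
by have : false by apply: h; clear; lia.
Qed.

End Split.

(** * Induction step for free components *)

Section FreeStep.
Variable r : nat.
Hypothesis free_r : forall r', (r' <= r)%N -> free_claim r'.
Hypothesis segment_r : segment_claim r.

Definition broken_or_halved S X T :=
  small_bound T S (weight r (r.+1 + 3 * nfree (edges T) S)) \/
  exists t Z, [/\ subtree t T, Z \in components (edges t), verts (edges t) :&: X = Z,
    (4 ^ r <= #|Z|)%N & (2 * #|Z| <= #|X|)%N].

(* Either some child breaks a component of [T] into several components, whose
   number pays for the loss of length, or the search can continue in a child. *)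
Lemma long_subtree T S X X' : X' \in components (edges T) -> [disjoint X' & S] ->
  X' \subset X -> verts (edges T) :&: X = X' -> (4 ^ r.+1 <= #|X|)%N ->
  (#|X| < 2 * #|X'|)%N -> broken_or_halved S X T.
Proof.
move=> + + + + Xr; have p0 : (0 < 4 ^ r)%N by rewrite expn_gt0.
elim: T X' => [i|a IHa b IHb] X' XT XS XX VX X2.
  have X'2 : (#|X'| <= 2)%N.
    by rewrite -(verts1_card i); exact: subset_leq_card (component_verts XT).
  by move: Xr X2 X'2 p0; rewrite expnS; clear; lia.
set T := Node a b in XT VX *.
(* For each child, either the goal is reached or the child keeps at most [4 ^ r] vertices of [X'].
   Both keeping so few would contradict [4 ^ r.+1 < 2 * #|X'|]. *)
have step c d : children c d T ->
    (forall X', X' \in components (edges c) -> [disjoint X' & S] ->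
      X' \subset X -> verts (edges c) :&: X = X' -> (#|X| < 2 * #|X'|)%N ->
      broken_or_halved S X c) ->
    broken_or_halved S X T \/ (#|verts (edges c) :&: X'| <= 4 ^ r)%N.
  move=> cdT IH; have cT := children_sub cdT.
  have subc t : subtree t c -> subtree t T by case: cdT => -> tc; right; [left|right].
  pose P := inner_components (edges c) X'; pose V := verts (edges c).
  have VP : V :&: X' \subset cover P.
    apply/subsetP => y /setIP[yV yX]; apply/bigcupP; exists (component (edges c) y).
      apply/inner_componentsP; split; first exact: component_components.
      by apply: (sub_component cT XT _ yX); [exact: component_components|exact: mem_component].
    exact: mem_component.
  have VPc : (#|V :&: X'| <= \sum_(Z in P) #|Z|)%N.
    exact: leq_trans (subset_leq_card VP) (leq_card_cover _).
  have [h1|h1] := leqP #|P| 1.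
    have [P0|] := eqVneq #|P| 0%N.
      right; apply: leq_trans VPc _; rewrite (cards0_eq P0) big_set0; exact: leq0n.
    rewrite -lt0n => h0; have /cards1P[Z PZ] : #|P| == 1%N by rewrite eqn_leq h1.
    have /inner_componentsP[Zc ZX] : Z \in P by rewrite PZ set11.
    have VZ : V :&: X' = Z.
      apply/eqP; rewrite eqEsubset; apply/andP; split.
        by move: VP; rewrite PZ /cover big_set1.
      by rewrite subsetI ZX component_verts.
    have VZX : V :&: X = Z.
      by rewrite -VZ -VX setIA (setIidPl (verts_sub cT)).
    rewrite -/V VZ; have [Z2|Z2] := ltnP #|X| (2 * #|Z|)%N.
      left; case: (IH Z Zc (disjointWl ZX XS) (subset_trans ZX XX) VZX Z2) => [h|[t [Y [tc ? ? ? ?]]]].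
        left; apply: bound_small; apply: (children_extend cdT h).
        have := nfree_sub0 S cT; clear; lia.
      by right; exists t, Y; split=> //; exact: subc.
    have [Zr|/ltnW Zr] := leqP (4 ^ r) #|Z|; last by right.
    left; right; exists c, Z; split=> //; exact: subc (subtree_refl c).
  (* The pieces are worth [3 * #|P|] but replace [X'], itself worth 3; to reach [r + 1], a long
     piece has to supply [r + 4 - 3 * #|P|]. *)
  have [/existsP[Z /andP[ZP Zr]]|] := boolP [exists Z in P, 4 ^ (r + 4 - 3 * #|P|) <= #|Z|]%N.
    left; left; apply: bound_small; have /inner_componentsP[Zc ZX] := ZP.
    have rr : (r + 4 - 3 * #|P| <= r)%N by move: h1; clear; lia.
    have h := free_r rr Zc (disjointWl ZX XS) Zr.
    apply: (bound_le _ (children_extend cdT h (leqnn _))).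
    apply: weight_le => //; have := nfree_sub_inner cT XS; have := nfree_component S XT.
    have : (nfree (edges T) (S :|: V :|: X') <= nfree (edges T) (S :|: V))%N.
      by apply: nfree_anti; exact: subsetUl.
    by rewrite -/P -/V; move: h1; clear; lia.
  rewrite negb_exists_in => /forall_inP hP; right.
  apply: leq_trans VPc _; apply: leq_trans (mul_expn4_le r h1).
  rewrite -sum_nat_const; apply: leq_sum => Z ZP.
  by rewrite -ltnS prednK ?expn_gt0 // ltnNge hP.
have [//|ha] := step a b (or_introl erefl) IHa.
have [//|hb] := step b a (or_intror erefl) IHb.
suff : (#|X'| <= 4 ^ r + 4 ^ r)%N by move: X2 Xr; rewrite expnS; clear; lia.
apply: leq_trans (leq_add ha hb); apply: leq_trans (leq_card_setU _ _).
apply: subset_leq_card; rewrite -setIUl -vertsU subsetI subxx andbT.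
exact: (component_verts XT).
Qed.

Lemma free_step : free_claim r.+1.
Proof.
move=> T S X XT XS Xr; have VX : verts (edges T) :&: X = X.
  by apply/setIidPr; exact: component_verts.
have p0 : (0 < 4 ^ r)%N by rewrite expn_gt0.
have X2 : (#|X| < 2 * #|X|)%N by move: Xr; rewrite expnS; clear - p0; lia.
have [h|[t [Z [tT Zt VZ Zr Z2]]]] := long_subtree XT XS (subxx X) VX Xr X2.
  by apply: small_bound_le h; exact: weight_le.
set V := verts (edges t) in VZ.
have ZX : Z \subset X by rewrite -VZ subsetIr.
have [Y [sY YX YZ Y4]] := side_segment XT (component_convex Zt) ZX Z2.
have Yr : (4 ^ r <= #|Y|)%N by move: Xr Y4; rewrite expnS; clear; lia.
have YSV : [disjoint Y & S :|: V].
  rewrite disjoint_setUr (disjointWl YX XS) /=; apply/negPn/negP => /meetP[y yY yV].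
  by have := disjointFr YZ yY; rewrite -VZ inE yV (subsetP YX y yY).
have h1 := free_r (leqnn r) Zt (disjointWl ZX XS) Zr.
have h2 := bound_small (segment_r sY YSV Yr).
set M := nfree (edges T) (S :|: V).
(* [X] meets [V] in [Z], so the components counted by [M] differ from [X] and avoid [Y]. *)
have MY : (M <= nfree (edges T) (S :|: V :|: Y))%N.
  apply: subset_leq_card; apply/subsetP => X' /free_componentsP[X'T X'S].
  apply/free_componentsP; split=> //; rewrite disjoint_setUr X'S /=.
  apply: disjointWr YX _; apply: components_disjoint X'T XT _; apply: contraTneq X'S => ->.
  rewrite disjoint_setUr negb_and; apply/orP; right; apply/meetP.
  have [z zZ] := component_neq0 Zt; exists z; first exact: (subsetP ZX).
  by move: zZ; rewrite -VZ => /setIP[].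
set N := nfree (edges T) S; have NM : (N <= nfree (edges t) S + M)%N.
  exact: nfree_sub0 (subtree_edges tT).
have rho0 m : 0 < rho ^+ m by rewrite exprn_gt0 // rho_gt0.
have W0 q p : 0 < weight q p by exact: weight_gt0.
(* The exponent [1 + 3 * M] balances the two terms: the sparse one has potential
   [r + 3 * nfree (edges t) S + 1 + 3 * M], the dense one at least
   [r + 2 + 3 * M + 3 * N - (1 + 3 * M)], and both reach [r.+1 + 3 * N]. Adding them costs the
   factor 2. *)
apply: small_bound_le (@small_bound_split t T S _ _ (1 + 3 * M) (W0 _ _) (W0 _ _) tT h1 h2).
have leV (x y : R) : 0 < x -> 0 < y -> y <= x^-1 -> x <= y^-1.
  by move=> x0 y0 yx; rewrite -[leLHS]invrK lef_pV2 ?posrE ?invr_gt0.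
apply: leV; first exact: W0.
  by apply: addr_gt0; do ![apply: mulr_gt0]; rewrite ?invr_gt0; try exact: W0; exact: rho0.
rewrite -/N.
have -> : (weight r.+1 (r.+1 + 3 * N))^-1 = (weight r (r.+1 + 3 * N))^-1 + (weight r (r.+1 + 3 * N))^-1.
  by rewrite /weight !invf_div exprS; ring.
apply: lerD.
  rewrite -invfM weightM lef_pV2 ?posrE //; apply: weight_le => //.
  by move: NM; clear; lia.
set w2 := weight r _; set q := rho ^+ (1 + 3 * M); set q' := rho ^+ (3 * _).
have inv3 (x y z : R) : x^-1 * y * z^-1 = (x * z / y)^-1 by rewrite !invfM invrK mulrAC.
rewrite inv3.
have q0 : 0 < w2 * q' / q by apply: divr_gt0; [apply: mulr_gt0; [exact: W0|exact: rho0]|exact: rho0].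
rewrite lef_pV2 ?posrE ?q0 ?W0 // ler_pdivlMr ?rho0 // /q /w2 /q' !weightM; apply: weight_le => //.
by move: MY; rewrite -/N; clear; lia.
Qed.

End FreeStep.

Lemma claims r : free_claim r /\ segment_claim r.
Proof.
elim/ltn_ind: r => -[|r] IH; first by split; [exact: free_claim0|exact: segment_claim0].
have hf r' : (r' <= r)%N -> free_claim r' by move=> h; exact: (IH r' h).1.
have hs r' : (r' <= r)%N -> segment_claim r' by move=> h; exact: (IH r' h).2.
split; first exact: (free_step hf (hs r (leqnn r))).
exact: segment_step.
Qed.

End Recursion.

(** * Splitting a pathset by join pattern *)

Lemma small_pathset_sub G A B : A \subset B -> small_pathset R G B -> small_pathset R G A.
Proof.
move=> AB [BG sB]; split; first exact: subset_trans BG.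
move=> t D tD DG Dt; apply: le_trans (sB t D tD DG Dt).
rewrite ler_wpM2r ?invr_ge0 ?exprn_ge0 // ler_nat.
apply/bigmax_leqP => z zV; apply: leq_trans (leq_bigmax_cond _ zV).
apply: subset_leq_card; apply/subsetP => y; rewrite !inE => /andP[-> /=].
exact: subsetP AB _.
Qed.

Lemma small_pathset0 G : small_pathset R G (set0 : {set passign n k}).
Proof.
split=> [|t D tD DG Dt]; first exact: sub0set.
apply: (@le_trans _ _ 0); last by rewrite invr_ge0 exprn_ge0 // powR_ge0.
rewrite /mu (_ : \max_(z in _) _ = 0%N) ?mul0r //.
apply/eqP; rewrite -leqn0; apply/bigmax_leqP => z _.
rewrite leqn0 cards_eq0; apply/eqP/setP => y; rewrite !inE andbF //.
Qed.

(** Every part is allowed the whole cost of [A]; the total overcount is at most the number of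
    patterns. *)
Definition decomposes f G A (F : jtree k -> {set passign n k}) :=
  [/\ forall T, built T (F T) ((chi R G A)%:R : R),
      forall T, F T \subset A,
      forall T, F T != set0 -> edges T = G
    & forall x, x \in A -> exists2 T, T \in patterns f G & x \in F T].

(** The factors of an optimal covering are decomposed recursively; the part for [Node a b] collects
    the joins of an [a]-part with a [b]-part. *)
Lemma decomposition f G A : (#|G| <= f)%N -> (0 < #|G|)%N -> pathset G A ->
  exists F, decomposes f G A F.
Proof.
elim: f G A => [|f IH] G A Gf G0 AG; first by move: Gf; rewrite leqNgt G0.
have [/eqP/cards1P[i Gi]|G1] := eqVneq #|G| 1%N.
  exists (fun T => if T == Leaf i then A else set0); split.
  - move=> T; have [->|_] := eqVneq T (Leaf i); last exact: built0.
    by rewrite /= -Gi chiE Gi cards1 /= -Gi.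
  - by move=> T; have [//|_] := eqVneq T (Leaf i); exact: sub0set.
  - by move=> T; have [-> _|_] := eqVneq T (Leaf i); [rewrite Gi|rewrite eqxx].
  move=> x xA; exists (Leaf i); last by rewrite eqxx.
  by rewrite /= Gi cards1 /= enum_set1 inE.
have G2 : (2 <= #|G|)%N by rewrite ltn_neqAle eq_sym G1.
have [] := nat_minP (covering_exists R (@chi R n k) n_gt0 k_gt1 G2 AG).
have <- : chi R G A = nat_min (covering_cost R (@chi R n k) G A).
  by rewrite [LHS]chiE (negbTE G1) (gtn_eqF G0).
move=> [m [H [K [B [C [HK sBC Aj chiA]]]]]] _.
have H0 i : (0 < #|H i|)%N /\ (0 < #|K i|)%N.
  have [pH pK HKi] := HK i; rewrite !card_gt0; split; apply/eqP => E.
    by move: pK; rewrite -HKi E set0U properxx.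
  by move: pH; rewrite -HKi E setU0 properxx.
have Hf i : (#|H i| <= f)%N /\ (#|K i| <= f)%N.
  have [/proper_card pH /proper_card pK _] := HK i.
  by split; rewrite -ltnS; exact: leq_trans Gf.
have /choice[FB FBP] i := IH (H i) (B i) (Hf i).1 (H0 i).1 (sBC i).1.1.
have /choice[FC FCP] i := IH (K i) (C i) (Hf i).2 (H0 i).2 (sBC i).2.1.
exists (fun T => if T is Node a b then A :&:
  \bigcup_i join (verts (edges a)) (verts (edges b)) (FB i a) (FC i b) else set0); split.
- case=> [i|a b]; first exact: built0.
  exists m, (FB^~ a), (FC^~ b), (fun i => (chi R (H i) (B i))%:R), (fun i => (chi R (K i) (C i))%:R).
  split; last 2 first.
  + exact: subsetIr.
  + by rewrite [in leRHS]chiA natr_sum; apply: ler_sum => i _; rewrite natrD.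
  + move=> i; have [h1 h2 h3 _] := FBP i; split=> //.
    (* A nonempty part determines the edge set of its tree, so smallness for [H i] carries over; an
       empty part is small for any graph. *)
    have [->|/h3 ->] := eqVneq (FB i a) set0; first exact: small_pathset0.
    exact: small_pathset_sub (sBC i).1.
  + move=> i; have [h1 h2 h3 _] := FCP i; split=> //.
    have [->|/h3 ->] := eqVneq (FC i b) set0; first exact: small_pathset0.
    exact: small_pathset_sub (sBC i).2.
- by case=> [i|a b]; [exact: sub0set|exact: subsetIl].
- case=> [i|a b]; first by rewrite eqxx.
  move=> /set0Pn[x /setIP[_ /bigcupP[i _]]]; rewrite inE => /and3P[_ xB xC] /=.
  have [_ _ hB _] := FBP i; have [_ _ hC _] := FCP i.
  have -> : edges a = H i by apply: hB; apply/set0Pn; eexists; exact: xB.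
  have -> : edges b = K i by apply: hC; apply/set0Pn; eexists; exact: xC.
  by have [_ _] := HK i.
move=> x xA; have /bigcupP[i _] := subsetP Aj x xA.
rewrite inE => /and3P[xHK xB xC]; have [pH pK HKi] := HK i.
have [_ _ hB /(_ _ xB)[Tb Tbp xTb]] := FBP i.
have [_ _ hC /(_ _ xC)[Tc Tcp xTc]] := FCP i.
have Eb : edges Tb = H i by apply: hB; apply/set0Pn; eexists; exact: xTb.
have Ec : edges Tc = K i by apply: hC; apply/set0Pn; eexists; exact: xTc.
exists (Node Tb Tc); last first.
  apply/setIP; split=> //; apply/bigcupP; exists i => //.
  by rewrite inE Eb Ec xHK xTb.
rewrite /= (negbTE G1); apply/flatten_mapP; exists (H i, K i).
  rewrite mem_enum !inE /= !(proper_sub pH, proper_sub pK).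
  by have [-> ->] := Hf i.
by apply/allpairsP; exists (Tb, Tc).
Qed.

(** The two free coordinates of the leftmost leaf give this factor, and [bound_extend] carries it
    up. *)
Lemma bound_sq T : bound T set0 (n%:R ^+ 2).
Proof.
elim: T => [i|a IHa b IHb].
  by have := @bound_leaf i set0; rewrite setD0 verts1_card.
have n2 : 0 < n%:R ^+ 2 :> R by rewrite exprn_gt0 // ltr0n.
apply: (bound_le _ (bound_extend (b := b) n2 (bound_small IHa))).
rewrite ler_peMr ?(ltW n2) //; apply: exprn_ege1; exact: rho_ge1.
Qed.

Lemma chi_lower_bound G A w : (0 < #|G|)%N -> pathset G A -> 0 <= w ->
  (forall T, edges T = G -> bound T set0 w) ->
  #|A|%:R * w <= 16 ^+ (2 ^ #|G|) * (chi R G A)%:R * n%:R ^+ #|verts G|.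
Proof.
move=> G0 AG w0 hw; have [F [hb _ hF cov]] := decomposition (leqnn #|G|) G0 AG.
pose P := patterns #|G| G.
have FT T : #|F T|%:R * w <= (chi R G A)%:R * n%:R ^+ #|verts G|.
  have [->|FT0] := eqVneq (F T) set0.
    by rewrite cards0 mul0r mulr_ge0 ?exprn_ge0.
  have ET := hF T FT0; have := hw T ET (F T) _ [ffun=> None] (hb T).
  rewrite ET setD0; apply: le_trans; apply: ler_wpM2r => //; rewrite ler_nat.
  apply: subset_leq_card; apply/subsetP => x xF; apply/fiberP; split=> //.
  by apply/agreesP => v; rewrite inE.
have cA : (#|A| <= \sum_(T <- P) #|F T|)%N.
  have AP : A \subset \bigcup_(T <- P) F T.
    by apply/subsetP => x /cov[T TP xT]; rewrite (big_rem T) //= inE xT.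
  apply: leq_trans (subset_leq_card AP) _.
  elim/big_rec2: _ => [|T q X _ h]; first by rewrite cards0.
  by apply: leq_trans (leq_card_setU _ _) _; rewrite leq_add2l.
apply: (@le_trans _ _ ((size P)%:R * ((chi R G A)%:R * n%:R ^+ #|verts G|))).
  apply: (@le_trans _ _ (\sum_(T <- P) (#|F T|%:R * w))).
    by rewrite -mulr_suml -natr_sum ler_wpM2r // ler_nat.
  apply: le_trans (ler_sum _ (fun T _ => FT T)) _.
  by rewrite big_const_seq count_predT iter_addr_0 [leRHS]mulr_natl.
rewrite mulrA; apply: ler_wpM2r; first by rewrite exprn_ge0.
apply: ler_wpM2r => //; rewrite -natrX ler_nat.
by apply: leq_trans (npatterns_le _); exact: size_patterns.
Qed.

(** * Application to the full path *)

Lemma verts_setT : verts [set: 'I_k] = [set: 'I_k.+1].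
Proof.
apply/setP => v; rewrite [RHS]inE; apply/vertsP.
have [vk|kv] := ltnP v k; first by exists (Ordinal vk); rewrite ?inE //= eqxx.
have kk : (k.-1 < k)%N by move: k_gt1; clear; lia.
exists (Ordinal kk); rewrite ?inE //=; apply/orP; right; apply/eqP.
by move: (ltn_ord v) kv kk; clear; lia.
Qed.

Lemma setT_component : [set: 'I_k.+1] \in components [set: 'I_k].
Proof.
apply/componentsP; exists ord0; first by rewrite verts_setT inE.
by apply/setP => v; rewrite !inE; apply/esym/linkedP => i _; rewrite inE.
Qed.

Lemma log2k_lt m : (k < 2 ^ m)%N -> log2 k%:R < m%:R :> R.
Proof.
move=> km; have ln2 : 0 < ln (2 : R) by rewrite ln_gt0 // ltr1n.
rewrite /log2 ltr_pdivrMr // mulr_natl -lnXn ?ltr0n //.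
by rewrite ltr_ln ?posrE ?exprn_gt0 ?ltr0n 1?ltnW // -natrX ltr_nat.
Qed.

Lemma log2k_ge m : (2 ^ m <= k)%N -> m%:R <= log2 k%:R :> R.
Proof.
move=> km; have ln2 : 0 < ln (2 : R) by rewrite ln_gt0 // ltr1n.
rewrite /log2 ler_pdivlMr // mulr_natl -lnXn ?ltr0n //.
by rewrite ler_ln ?posrE ?exprn_gt0 ?ltr0n 1?ltnW // -natrX ler_nat.
Qed.

(* For [k = 2] the claims are void, as [ntilde = 1]; for [k <= 3] the factor
   [n ^ 2] of a single edge is enough. *)
Lemma path_bound : exists2 w : R,
  n%:R `^ (1 / 6 * log2 k%:R) / 2 ^+ (2 ^ k) <= w &
  forall T, edges T = [set: 'I_k] -> bound T set0 w.
Proof.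
have n1 : 1 <= n%:R :> R by rewrite ler1n.
have p1 m : 1 <= 2 ^+ m :> R by rewrite exprn_ege1 // ler1n.
have p0 m : 0 < 2 ^+ m :> R by rewrite exprn_gt0.
have [k4|k4] := ltnP k 4.
  exists (n%:R ^+ 2) => [|T _]; last exact: bound_sq.
  apply: (@le_trans _ _ (n%:R `^ (1 / 6 * log2 k%:R))).
    by rewrite ler_pdivrMr // ler_peMr ?powR_ge0.
  rewrite -powR_mulrn // ler_powR //.
  by have := @log2k_lt 2 k4; lra.
(* The whole path is a segment with [k.+1] vertices, so [r] is about half of [log k]; a third for
   each unit of [r] gives the factor 1/6. *)
pose r := trunc_log 4 k.+1.
have /andP[r1 r2] : (4 ^ r <= k.+1 < 4 ^ r.+1)%N by apply: trunc_log_bounds.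
exists (weight r (r + 2)) => [|T ET].
  apply: ler_pM.
  - exact: powR_ge0.
  - by rewrite invr_ge0 ltW.
  - rewrite /rho -powR_mulrn ?powR_ge0 // -powRrM ler_powR //.
    have L1 : log2 k%:R < 2 * r%:R + 2 :> R.
      have -> : 2 * r%:R + 2 = (2 * r.+1)%:R :> R by rewrite natrM -natr1; ring.
      by apply: log2k_lt; rewrite expnM; apply: leq_trans r2; rewrite ltnS.
    have L2 : 2 <= log2 k%:R :> R by apply: (@log2k_ge 2).
    rewrite natrD; set L := log2 _ in L1 L2 *; set s : R := r%:R in L1 *.
    have L0 : 0 < L by lra.
    (* As [s + 2 > L / 2 + 1], the inequality reduces to [(L - 1) * (L + 2) >= L ^ 2], that is,
       [L >= 2]. *)
    rewrite -(ler_pM2r L0); have -> : (1 - 1 / L) / 3 * (s + 2) * L = (L - 1) * (s + 2) / 3.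
      by field; rewrite lt0r_neq0.
    nra.
  - rewrite lef_pV2 ?posrE //; apply: ler_weXn2l; first by rewrite ler1n.
    have rr := ltn_expl r (isT : (1 < 4)%N); have kk := ltn_expl k (isT : (1 < 2)%N).
    by move: rr kk r1; clear; lia.
have [_ cl] := claims r.
have sY : segment (edges T) [set: 'I_k.+1].
  rewrite ET; split; first by move=> x y z _ _ _; rewrite inE.
  by exists [set: 'I_k.+1]; [exact: setT_component|exact: subxx].
have dY : [disjoint [set: 'I_k.+1] & (set0 : {set 'I_k.+1})] by rewrite disjoint_sym -setI_eq0 set0I.
have := cl T set0 _ sY dY; rewrite cardsT card_ord => /(_ r1).
by apply: bound_le; apply: weight_le => //; exact: leq_addr.
Qed.

End Costs.

Theorem theorem5p8 (R : realType) :
  exists C : R, 0 < C /\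
    forall n k : nat, (1 <= n)%N -> (2 <= k)%N ->
    forall A : {set passign n k}, pathset [set: 'I_k] A ->
      n%:R `^ (1 / 6 * log2 k%:R) / 2 `^ (C * 2 ^+ k)
        * density R (verts [set: 'I_k]) A
      <= (chi R [set: 'I_k] A)%:R.
Proof.
(* [path_bound] loses [2 ^ 2 ^ k], and the number of join patterns loses [16 ^ 2 ^ k], its fourth
   power. *)
exists 5; split=> // n k n_gt0 k_gt1 A AG.
have [w w1 w2] := path_bound R n_gt0 k_gt1.
have n0 m : 0 < n%:R ^+ m :> R by rewrite exprn_gt0 // ltr0n.
have q0 m : 0 < 2 ^+ m :> R by rewrite exprn_gt0.
have w0 : 0 <= w by apply: le_trans w1; rewrite divr_ge0 ?powR_ge0 // ltW.
have k0 : (0 < #|[set: 'I_k]|)%N by rewrite cardsT card_ord ltnW.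
have := chi_lower_bound n_gt0 k_gt1 k0 AG w0 w2.
rewrite cardsT card_ord /density mulrA ler_pdivrMr //.
have -> : (16 : R) = 2 ^+ 4 by rewrite -natrX.
rewrite -exprM => h.
have -> : 2 `^ (5 * 2 ^+ k) = 2 ^+ (2 ^ k) * 2 ^+ (4 * 2 ^ k) :> R.
  by rewrite -exprD -[RHS]powR_mulrn // natrD natrM natrX; congr (_ `^ _); ring.
set x := n%:R `^ _ in w1 *; set q1 : R := 2 ^+ (2 ^ k) in w1 *; set q2 : R := 2 ^+ (4 * _) in h *.
have -> : x / (q1 * q2) * #|A|%:R = x / q1 * #|A|%:R / q2 by rewrite invfM; ring.
rewrite ler_pdivrMr ?q0 //; apply: le_trans (ler_wpM2r _ w1) _ => //.
by rewrite mulrC; apply: le_trans h _; rewrite le_eqVlt; apply/orP; left; apply/eqP; ring.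
Qed.
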